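(* Let $G\subset \mathrm{SL}(2,\mathbb C)$ be a finite abelian subgroup of cardinality $k=|G|$. Then the space of generic stability conditions $\Theta^{\mathrm{gen}}$ for $G$-constellations on $\mathbb A^2$ contains $k\cdot 2^{k-2}$ simple chambers.
   Context: Basic setting. Everything is over $\mathbb C$, and $\mathbb N=\{0,1,2,\dots\}$. Up to conjugation, $G\cong\mathbb Z/k\mathbb Z$ is the subgroup of $\mathrm{SL}(2,\mathbb C)$ generated by $g_k=\mathrm{diag}(\xi_k^{-1},\xi_k)$, with $\xi_k$ a fixed primitive $k$-th root of unity. $G$ acts on $\mathbb C[x,y]$ by $g\cdot p=p\circ g^{-1}$. Its irreducible representations are $\rho_i$, $\rho_i(g_k)=\xi_k^i$, $i=0,\dots,k-1$ (indices modulo $k$); thus $x^iy^j$ belongs to $\rho_{i-j}$. A $G$-constellation is a coherent $G$-equivariant sheaf $\mathscr F$ on $\mathbb A^2$ with $H^0(\mathbb A^2,\mathscr F)\cong\mathbb C[G]$ as representations; it is identified with the $G$-equivariant $\mathbb C[x,y]$-module $H^0(\mathbb A^2,\mathscr F)$. It is indecomposable if it is not a direct sum of two proper $G$-subsheaves. It is toric if it is indecomposable and admits a structure of equivariant sheaf for the standard torus $\mathbb T^2=(\mathbb C^* )^2$ acting diagonally on $\mathbb A^2$ (equivalently it is a torus-fixed point of a moduli space of stable $G$-constellations). Stability. $\Theta=\{\theta\in\mathrm{Hom}_{\mathbb Z}(R(G),\mathbb Q)\mid \theta(\mathbb C[G])=0\}$, with $R(G)$ the representation ring. $\mathscr F$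 is $\theta$-(semi)stable if $\theta(H^0(\mathscr E))>0$ ($\ge0$) for every $G$-equivariant subsheaf $0\subsetneq\mathscr E\subsetneq\mathscr F$; $\theta$ is generic if $\theta$-semistability is equivalent to $\theta$-stability; $\Theta^{\mathrm{gen}}$ is the set of generic $\theta$. It is a disjoint union of finitely many open convex polyhedral cones (its connected components), called chambers; stability is constant on a chamber $C$, so one speaks of $C$-stable $G$-constellations. Stairs. The representation tableau is $\mathscr T_G=\{(i,j,t)\in\mathbb N^2\times\{0,\dots,k-1\}\mid i-j\equiv t \bmod k\}$: boxes of the plane $\mathbb N^2$, the box $(i,j)$ carrying the monomial $x^iy^j$ and the label $\rho_{i-j}$. A Ferrers diagram is a finite $A\subset\mathbb N^2$ with $(\mathbb N^2\smallsetminus A)+\mathbb N^2\subset\mathbb N^2\smallsetminus A$; a skew Ferrers diagram is a difference $A_1\smallsetminus A_2$ of two Ferrers diagrams; it is connected if, for any decomposition of it into two disjoint nonempty subsets, some box of one shares an edge with some box of the other. A stair is a connected skew Ferrers diagram $\Gamma$ (with the labels of $\mathscr T_G$) such that $(m,n)\in\Gamma$ implies $(m+1,n+1),(m-1,n-1)\notin\Gamma$. Its boxes are totally ordered from the upper left (first) to the lower right (last): each successive box is immediately to the right of or immediately below the previous one. A $G$-stair is a stair with exactly $k$ boxes. An abstract stair is a labelled diagram that can be realized in $\mathscr T_G$ as a stair. The generators of a stair are its boxes having neither the box immediately to the left nor the box immediately below in the stair. For a skew Ferrers diagram $\Gamma=A_1\smallsetminus A_2$, put $M_\Gamma=I_{A_2}/(I_{A_2}\cap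 I_{A_1})$ where $I_A$ is the ideal generated by the monomials not in $A$. Each toric $G$-constellation is isomorphic to $M_\Gamma$ for a $G$-stair $\Gamma$, unique as an abstract $G$-stair. The width of a stair is the width of the smallest rectangle containing it. Chamber stairs. For each chamber $C$ there are exactly $k$ toric $C$-stable $G$-constellations $\mathscr F_1,\dots,\mathscr F_k$, ordered so that the abstract $G$-stair $\Gamma_j$ of $\mathscr F_j$ has width $j$. Let $L_j$ be the abstract stair of $2k$ boxes obtained from two copies of $\Gamma_j$ by gluing the right edge of the last box of the first copy to the left edge of the first box of the second copy. Then $\Gamma_{j+1}$ is a substair of $L_j$ meeting the first copy of $\Gamma_j$ in a nonempty final segment of $\Gamma_j$. The abstract $C$-stair $\Gamma_C$ is the abstract stair obtained by gluing, for all $j=1,\dots,k-1$, the stairs $\Gamma_j$ and $\Gamma_{j+1}$ along this common part. Two abstract stairs have the same generators if they admit realizations in $\mathscr T_G$ whose sets of generators coincide. A chamber $C$ is simple if there is a toric $C$-stable $G$-constellation whose abstract $G$-stair has the same generators as the abstract $C$-stair.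
   Formalization: The formal theorem assumes that G is nontrivial (k at least 2): for k = 1 the stated number k·2^(k-2) is 1/2, whereas the trivial group has exactly one chamber, which is simple. *)

(* Defs.v *)
From HB Require Import structures.
From mathcomp Require Import all_boot all_order all_algebra all_fingroup.
From mathcomp Require Import mxrepresentation finmap.
From mathcomp Require Import boolp classical_sets functions cardinality reals.
From mathcomp Require Export complex.
From Stdlib Require Import Relations.

Set Implicit Arguments.
Unset Strict Implicit.
Unset Printing Implicit Defensive.

Import Order.TTheory GRing.Theory Num.Theory.

Local Open Scope ring_scope.

(** * Stairs in the representation tableau

  The box [(i, j)] sits in column [i] and row [j] (rows are counted upwards);
  it carries the monomial [x^i y^j].  In the tableau of [Z/kZ] its label
  [i - j mod k] is determined by its position, so stairs of the tableau are
  plain finite sets of boxes. *)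

Definition box : Type := (nat * nat)%type.

Definition right_of (p : box) : box := (p.1.+1, p.2).
Definition above (p : box) : box := (p.1, p.2.+1).

Definition ferrers (A : {fset box}) : Prop :=
  forall p q : box, p \notin A -> (p.1 + q.1, p.2 + q.2)%N \notin A.

Definition skew_ferrers (S : {fset box}) : Prop :=
  exists A1 A2 : {fset box}, [/\ ferrers A1, ferrers A2 & S = (A1 `\` A2)%fset].

Definition share_edge (p q : box) : Prop :=
  [\/ q = right_of p, p = right_of q, q = above p | p = above q].

Definition connected_boxes (S : {fset box}) : Prop :=
  forall B1 B2 : {fset box},
    B1 != fset0 -> B2 != fset0 -> (B1 `&` B2)%fset = fset0 ->
    (B1 `|` B2)%fset = S ->
    exists p q, [/\ p \in B1, q \in B2 & share_edge p q].

(* The condition at [(m-1, n-1)] is the contrapositive of the one stated. *)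
Definition stair (S : {fset box}) : Prop :=
  [/\ skew_ferrers S, connected_boxes S &
      forall m n : nat, (m, n) \in S -> (m.+1, n.+1) \notin S].

Definition G_stair (k : nat) (S : {fset box}) : Prop :=
  stair S /\ #|` S| = k.

(* An abstract stair is represented by any of its realizations; two subsets of
   the tableau realize the same labelled diagram when they differ by a
   translation of the plane that preserves the labels mod [k].  The vector of
   the translation is [(a.1 - b.1, a.2 - b.2)]. *)
Definition same_abstract (k : nat) (S S' : {fset box}) : Prop :=
  exists a b : box,
    [fset (p.1 + a.1, p.2 + a.2)%N | p in S]%fset
      = [fset (p.1 + b.1, p.2 + b.2)%N | p in S']%fset
    /\ (a.1 + b.2 = b.1 + a.2 %[mod k])%N.

(* Order of the boxes of a stair, from the upper left to the lower right. *)
Definition before (p q : box) : bool := (p.1 <= q.1)%N && (q.2 <= p.2)%N.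

Definition first_box (S : {fset box}) (p : box) : Prop :=
  p \in S /\ forall q, q \in S -> before p q.

Definition last_box (S : {fset box}) (p : box) : Prop :=
  p \in S /\ forall q, q \in S -> before q p.

(* Number of columns of the smallest rectangle containing [S]. *)
Definition width (S : {fset box}) : nat :=
  (\max_(p <- S) \max_(q <- S) (p.1 - q.1).+1)%N.

Definition generators (S : {fset box}) : {fset box} :=
  [fset p in S | [forall q : S, (p != right_of (val q)) && (p != above (val q))]]%fset.

Definition same_generators (k : nat) (S S' : {fset box}) : Prop :=
  exists T T' : {fset box},
    [/\ same_abstract k S T, same_abstract k S' T'
      & generators T = generators T'].

Definition final_segment (S T : {fset box}) : Prop :=
  (T `<=` S)%fset
  /\ forall p q, p \in T -> q \in S -> before p q -> q \in T.

(* [S] and [S2] are the two copies forming the stair of [2k] boxes; [S'] is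
   placed inside it so that [S] and [S'] are glued along [S `&` S']. *)
Definition consecutive (k : nat) (S S' : {fset box}) : Prop :=
  exists S2 : {fset box},
    [/\ same_abstract k S S2,
        exists p, last_box S p /\ first_box S2 (right_of p),
        (S' `<=` S `|` S2)%fset,
        (S `&` S')%fset != fset0
      & final_segment S (S `&` S')%fset].

(** * G-constellations

  [rG] is the inclusion of [G] in the matrices acting on the column vectors of
  the affine plane.  A G-equivariant [C[x,y]]-module of finite length is a
  vector space with an action of [G] and two commuting endomorphisms. *)

Section Constellations.

Variables (C : fieldType) (gT : finGroupType).
Variable rG : mx_representation C [set: gT] 2.

Record gmodule := GModule {
  carrier :> vectType C;
  grp_act : gT -> 'End(carrier);
  mulx : 'End(carrier);
  muly : 'End(carrier)
}.

(* [g (p v) = (g . p) (g v)] with [g . p = p \o g^-1], for [p] equal to each of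
   the two coordinate functions. *)
Definition equivariant (M : gmodule) : Prop :=
  [/\ grp_act M 1%g = \1%VF,
      forall g h, grp_act M (g * h)%g = (grp_act M g \o grp_act M h)%VF,
      (mulx M \o muly M)%VF = (muly M \o mulx M)%VF,
      forall g, (grp_act M g \o mulx M)%VF =
        ((rG g^-1%g 0 0 *: mulx M + rG g^-1%g 0 1 *: muly M) \o grp_act M g)%VF
    & forall g, (grp_act M g \o muly M)%VF =
        ((rG g^-1%g 1 0 *: mulx M + rG g^-1%g 1 1 *: muly M) \o grp_act M g)%VF].

(* The second clause is an isomorphism with the regular representation. *)
Definition constellation (M : gmodule) : Prop :=
  equivariant M
  /\ exists f : 'Hom(M, {ffun gT -> C^o}),
       bijective f
       /\ forall h v, f (grp_act M h v) = [ffun g => f v (h^-1 * g)%g].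

Definition isomorphic (M N : gmodule) : Prop :=
  exists f : 'Hom(M, N),
    [/\ bijective f,
        forall g, (f \o grp_act M g)%VF = (grp_act N g \o f)%VF,
        (f \o mulx M)%VF = (mulx N \o f)%VF
      & (f \o muly M)%VF = (muly N \o f)%VF].

Definition subsheaf (M : gmodule) (E : {vspace M}) : Prop :=
  [/\ forall g, (grp_act M g @: E <= E)%VS,
      (mulx M @: E <= E)%VS & (muly M @: E <= E)%VS].

Definition indecomposable (M : gmodule) : Prop :=
  forall E1 E2 : {vspace M}, subsheaf E1 -> subsheaf E2 ->
    (E1 + E2)%VS = fullv -> (E1 :&: E2)%VS = 0%VS ->
    E1 = fullv \/ E2 = fullv.

(* A regular action of the torus on the sheaf, by automorphisms of its
   G-structure; [(s, t)] acts on functions by [x |-> s^-1 x], [y |-> t^-1 y].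
   The values of [tau] off the torus are irrelevant. *)
Definition torus_equivariant (M : gmodule) : Prop :=
  exists tau : C -> C -> 'End(M),
    tau 1 1 = \1%VF
    /\ (forall s t s' t', s != 0 -> t != 0 -> s' != 0 -> t' != 0 ->
          tau (s * s') (t * t') = (tau s t \o tau s' t')%VF)
    /\ (exists (r : seq (int * int)) (A : int * int -> 'End(M)),
          forall s t, s != 0 -> t != 0 ->
            tau s t = \sum_(p <- r) (s ^ p.1 * t ^ p.2) *: A p)
    /\ (forall s t, s != 0 -> t != 0 ->
          [/\ (tau s t \o mulx M)%VF = s^-1 *: (mulx M \o tau s t)%VF,
              (tau s t \o muly M)%VF = t^-1 *: (muly M \o tau s t)%VF
            & forall g, (tau s t \o grp_act M g)%VF = (grp_act M g \o tau s t)%VF]).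

Definition toric (M : gmodule) : Prop :=
  [/\ constellation M, indecomposable M & torus_equivariant M].

(** The module [M_S = I_{A2} / (I_{A2} :&: I_{A1})] of [S = A1 `\` A2], in its
  basis of monomials [x^i y^j], [(i, j) \in S].  A coordinate acts by shifting
  the boxes, a box leaving [S] being sent to 0.  The formula for the action of
  [G] assumes that [rG] is diagonal. *)
Definition stair_module (S : {fset box}) : gmodule :=
  @GModule {ffun S -> C^o}
    (fun g => linfun (fun f : {ffun S -> C^o} => [ffun p : S =>
       (rG g^-1%g 0 0 ^+ (val p).1 * rG g^-1%g 1 1 ^+ (val p).2) *: f p]))
    (linfun (fun f : {ffun S -> C^o} => [ffun p : S =>
       \sum_(q : S | right_of (val q) == val p) f q]))
    (linfun (fun f : {ffun S -> C^o} => [ffun p : S =>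
       \sum_(q : S | above (val q) == val p) f q])).

Definition stair_of (M : gmodule) (S : {fset box}) : Prop :=
  G_stair #|gT| S /\ isomorphic M (stair_module S).

(** * Stability

  [G] is generated by [g0] and [xi] is a primitive root of unity of order
  [#|G|]; the irreducible representation [rho_i] is the character sending [g0]
  to [xi ^+ i].  A homomorphism from the representation ring to the rationals
  is given by its values on the [rho_i]. *)

Variables (g0 : gT) (xi : C).

Definition stability : Type := {ffun 'I_#|gT| -> rat}.

Definition Theta : set stability :=
  [set th : stability | \sum_i th i = 0]%classic.

Definition theta_val (th : stability) (M : gmodule) (E : {vspace M}) : rat :=
  \sum_i th i *+ \dim (E :&: passmx.leigenspace (grp_act M g0) (xi ^+ i))%VS.

Definition stable (th : stability) (M : gmodule) : Prop :=
  forall E : {vspace M}, subsheaf E -> E <> 0%VS -> E <> fullv ->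
    0 < theta_val th E.

Definition semistable (th : stability) (M : gmodule) : Prop :=
  forall E : {vspace M}, subsheaf E -> E <> 0%VS -> E <> fullv ->
    0 <= theta_val th E.

Definition Theta_gen : set stability :=
  [set th | Theta th
     /\ forall M, constellation M -> (semistable th M <-> stable th M)]%classic.

(* [Theta] is a rational vector space, totally disconnected as a subspace of
   the Euclidean one.  Its generic locus is the complement of finitely many
   rational hyperplanes, and the connected components of the corresponding
   real locus are recovered as the classes for linkage by rational polygonal
   lines. *)
Definition segment_in_gen (th th' : stability) : Prop :=
  forall t : rat, 0 <= t <= 1 ->
    Theta_gen [ffun i => (1 - t) * th i + t * th' i].

Definition chamber (K : set stability) : Prop :=
  exists2 th, Theta_gen th
    & K = [set th' | clos_refl_trans stability segment_in_gen th th']%classic.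

Definition chamber_stable (K : set stability) (M : gmodule) : Prop :=
  constellation M /\ forall th, K th -> stable th M.

(* All the [S j] are placed in one copy of the plane, so that the gluing is
   their union. *)
Definition chamber_stair (K : set stability) (SK : {fset box}) : Prop :=
  exists (F : nat -> gmodule) (S : nat -> {fset box}),
    [/\ forall j, (0 < j <= #|gT|)%N ->
          [/\ toric (F j), chamber_stable K (F j), stair_of (F j) (S j)
            & width (S j) = j],
        forall j, (0 < j < #|gT|)%N -> consecutive #|gT| (S j) (S j.+1)
      & SK = (\bigcup_(j <- iota 1 #|gT|) S j)%fset].

Definition simple_chamber (K : set stability) : Prop :=
  chamber K
  /\ exists (M : gmodule) (S SK : {fset box}),
       [/\ toric M, chamber_stable K M, stair_of M S, chamber_stair K SK
         & same_generators #|gT| S SK].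

End Constellations.

(** Linear coordinates of the plane in which [G] is the subgroup generated by
  [diag (xi^-1, xi)]. *)
Record diag_coords (C : fieldType) (gT : finGroupType)
    (rG : mx_representation C [set: gT] 2) := DiagCoords {
  dc_mx : 'M[C]_2;
  dc_unit : dc_mx \in unitmx;
  dc_gen : gT;
  dc_root : C;
  dc_prim : #|gT|.-primitive_root dc_root;
  dc_generates : <[dc_gen]>%g = [set: gT]%SET;
  dc_diag : rconj_repr rG dc_unit dc_gen
            = diag_mx (\row_(i < 2) (if i == 0 then dc_root^-1 else dc_root))
}.

Definition simple_chambers (C : fieldType) (gT : finGroupType)
    (rG : mx_representation C [set: gT] 2) (d : diag_coords rG)
    : set (set (stability gT)) :=
  [set K | simple_chamber (rconj_repr rG (dc_unit d)) (dc_gen d) (dc_root d) K]%classic.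

(* Main.v *)
(* Writing s(t) for the partial sums of theta over the labels 0, .., t - 1, theta
   is generic iff s is injective on Z/k, and the chambers are the k! orders of the
   values of s.  A stable stair whose first label is c goes right when it enters t
   if s(t) < s(c) and down otherwise, so its width is the rank of s(c).  Hence the
   j-th stair of a chamber starts at the label c_j of rank j, and along the glued
   stair the start d_j is the first position after d_(j-1) with label c_j.  The
   chamber stair has generators at positions d_1 + k - 1 and d_k and none outside
   of this range, so the chamber is simple iff d_k < d_1 + 2k - 1, i.e. iff the
   sequence (c_j) goes at most twice around Z/k.  Such a sequence is given by c_1
   (k choices) and by the set of labels met on the second turn, an arbitrary
   subset of the k - 2 labels other than c_1 and c_1 - 1. *)

Require Import Defs.
From HB Require Import structures.
From mathcomp Require Import all_boot all_order all_algebra all_fingroup.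
From mathcomp Require Import mxrepresentation finmap cyclic cyclotomic separable.
From mathcomp Require Import boolp classical_sets functions cardinality reals.
From mathcomp Require Import zify ring lra.

Set Implicit Arguments.
Unset Strict Implicit.
Unset Printing Implicit Defensive.

Import Order.TTheory GRing.Theory Num.Theory.
Local Open Scope ring_scope.

(** * Stairs as paths *)


(** Each label of a constellation is carried by a single line, so a subsheaf amounts to a set of
    labels, and its theta value is the sum of s(t+1) - s(t) over that set. On a cyclic run of labels
    this telescopes to a difference of two values of s. This is why the walls are exactly the ties
    of s for all constellations, toric or not, and why the stability of a stair is decided by
    cutting it at one place.

    Stairs come only up to isomorphism and translation. The invariant that survives is the diagonal
    i - j taken in the integers: it lifts the label, enumerates the boxes of a stair, moves by one
    constant under a translation, and orders the glued stair. Gluing, widths and generators thus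
    become inequalities between integers.

    The label c_1 - 1 has no choice of turn because on the second one it would start a stair at d_1
    + 2k - 1, just beyond the range allowed to a simple chamber. Being always at d_1 + k - 1, it
    separates the two turns, and its stair is the one that has the generators of the chamber
    stair. *)

Definition diag (p : box) : int := p.1%:Z - p.2%:Z.

Lemma diag_right p : diag (right_of p) = diag p + 1.
Proof. by case: p => a b; rewrite /diag /=; lia. Qed.

Lemma diag_above p : diag (above p) = diag p - 1.
Proof. by case: p => a b; rewrite /diag /=; lia. Qed.

(* [b] enumerates the boxes of a stair from the upper left to the lower right;
   [diag] grows by one at each step, so that labels are its residues mod [k]. *)
Definition is_path (S : {fset box}) (k : nat) (b : nat -> box) : Prop :=
  [/\ forall i, (i < k)%N -> b i \in S,
      forall p, p \in S -> exists2 i, (i < k)%N & p = b i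
    & forall i, (i.+1 < k)%N -> b i.+1 = right_of (b i) \/ b i = above (b i.+1)].

Definition weakly_below (q p : box) : bool := (q.1 <= p.1)%N && (q.2 <= p.2)%N.

Section Path.
Variables (S : {fset box}) (k : nat) (b : nat -> box).
Hypothesis Sb : is_path S k b.

Lemma path_diag i : (i < k)%N -> diag (b i) = diag (b 0%N) + i%:Z.
Proof.
case: Sb => _ _ st; elim: i => [|i IH] ik; first by rewrite addr0.
have {IH} := IH (ltnW ik); case: (st i ik) => [->|->]; rewrite ?diag_right ?diag_above; lia.
Qed.

Lemma path_diag_inj p q : p \in S -> q \in S -> diag p = diag q -> p = q.
Proof.
case: Sb => _ ex _ /ex [i ik ->] /ex [j jk ->].
by rewrite (path_diag ik) (path_diag jk) => e; congr (b _); lia.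
Qed.

Lemma path_diagP p : p \in S ->
  exists2 i, (i < k)%N & p = b i /\ diag p = diag (b 0%N) + i%:Z.
Proof.
by case: (Sb) => _ ex _ /ex [i ik ->]; exists i => //; split=> //; exact: path_diag.
Qed.

Lemma path_mono i j : (i <= j)%N -> (j < k)%N ->
  ((b i).1 <= (b j).1)%N && ((b j).2 <= (b i).2)%N.
Proof.
case: Sb => _ _ st; elim: j => [|j IH].
  by rewrite leqn0 => /eqP-> _; rewrite !leqnn.
rewrite leq_eqVlt => /orP[/eqP-> _|ij jk]; first by rewrite !leqnn.
have := IH ij (ltnW jk).
by case: (st j jk) => -> /=; lia.
Qed.

(** Columns grow and rows fall along a path, so two comparable boxes lie in one row or in one
    column, and the path between them is straight. This convexity is what makes a path a skew
    diagram. *)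
Lemma path_convex (p q r : box) : p \in S -> q \in S ->
  (p.1 <= r.1 <= q.1)%N -> (p.2 <= r.2 <= q.2)%N -> r \in S.
Proof.
move=> /path_diagP[i ik [-> di]] /path_diagP[j jk [-> dj]] h1 h2.
case: (Sb) => mem _ _.
have [ij|ji] := leqP i j.
  have := path_mono ij jk => m.
  have ink : (i + (r.1 - (b i).1) < k)%N by move: di dj; rewrite /diag; lia.
  have inj : (i + (r.1 - (b i).1) <= j)%N by move: di dj; rewrite /diag; lia.
  suff -> : r = b (i + (r.1 - (b i).1))%N by exact: mem.
  have m1 := path_mono inj jk; have m2 := path_mono (leq_addr (r.1 - (b i).1) i) ink.
  have := path_diag ink; move: di dj.
  case: r h1 h2 m1 m2 {ink inj} => r1 r2; case: (b (i + _)%N) => u v /=; rewrite /diag /=.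
  by move=> *; congr (_, _); lia.
have := path_mono (ltnW ji) ik => m.
have jnk : (j + ((b j).2 - r.2) < k)%N by move: di dj; rewrite /diag; lia.
have jni : (j + ((b j).2 - r.2) <= i)%N by move: di dj; rewrite /diag; lia.
suff -> : r = b (j + ((b j).2 - r.2))%N by exact: mem.
have m1 := path_mono jni ik; have m2 := path_mono (leq_addr ((b j).2 - r.2) j) jnk.
have := path_diag jnk; move: di dj.
case: r h1 h2 m1 m2 {jnk jni} => r1 r2; case: (b (j + _)%N) => u v /=; rewrite /diag /=.
by move=> *; congr (_, _); lia.
Qed.

Lemma path_card : #|` S| = k.
Proof.
case: Sb => mem ex _.
have -> : S = [fset b (val i) | i in 'I_k]%fset.
  apply/fsetP => p; apply/idP/imfsetP => /= [/ex[i ik ->]|[i _ ->]]; last exact: mem.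
  by exists (Ordinal ik).
rewrite card_imfset /=; first by rewrite -cardE card_ord.
move=> i j /(congr1 diag); rewrite (path_diag (ltn_ord i)) (path_diag (ltn_ord j)) => e.
by apply: val_inj => /=; lia.
Qed.

Lemma path_skew : skew_ferrers S.
Proof.
pose N := (\max_(p <- S) (p.1 + p.2).+1)%N.
(* [A1] is the closure of [S] to the left and below; the bound [N] only serves to present it as a
   finite set. That [A1] minus [S] is again closed is the convexity of [S]. *)
pose A1 := [fset q in [seq (i, j) | i <- iota 0 N, j <- iota 0 N] |
  has (weakly_below q) S]%fset.
have A1P q : reflect (exists2 p, p \in S & weakly_below q p) (q \in A1).
  apply: (iffP idP) => [|[p pS le]].
    by rewrite !inE => /andP[_ /hasP[p pS le]]; exists p.
  rewrite !inE; apply/andP; split; last by apply/hasP; exists p.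
  have : ((p.1 + p.2).+1 <= N)%N by apply: (leq_bigmax_seq (F := fun p : box => (p.1 + p.2).+1) p).
  case: q le => q1 q2; rewrite /weakly_below /= => le H.
  by apply/allpairsP; exists (q1, q2); rewrite !mem_iota /=; split => //; lia.
exists A1, (A1 `\` S)%fset; split.
- move=> p q; apply: contra => /A1P[r rS le]; apply/A1P; exists r => //.
  by move: le; rewrite /weakly_below /=; lia.
- move=> p q; apply: contra; rewrite 2!in_fsetD => /andP[nS /A1P[r rS le]].
  have pA : p \in A1 by apply/A1P; exists r => //; move: le; rewrite /weakly_below /=; lia.
  rewrite pA andbT; apply: contra nS => pS.
  by move: le; rewrite /weakly_below /= => le; apply: (@path_convex p r) => //=; lia.
- apply/fsetP => p; rewrite 2!in_fsetD.
  have [pS|pS] := boolP (p \in S); last by rewrite andNb.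
  by rewrite negb_and negbK orTb; apply/esym/A1P; exists p; rewrite // /weakly_below !leqnn.
Qed.

Lemma path_connected : connected_boxes S.
Proof.
case: Sb => mem ex st B1 B2 /fset0Pn[p pB] /fset0Pn[q qB] dis uni.
have in12 i : (i < k)%N -> (b i \in B1) || (b i \in B2).
  by move=> /mem; rewrite -uni inE.
have pS : p \in S by rewrite -uni inE pB.
have qS : q \in S by rewrite -uni inE qB orbT.
have noboth r : r \in B1 -> r \in B2 -> False.
  by move=> h1 h2; have : r \in fset0 by rewrite -dis inE h1 h2.
(* A membership that differs at two indices changes between two successive boxes, and these share an
   edge. *)
have key i n : (i + n < k)%N -> (b i \in B1) != (b (i + n)%N \in B1) ->
    exists2 j, (j.+1 < k)%N & (b j \in B1) != (b j.+1 \in B1).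
  elim: n => [|n IH]; first by rewrite addn0 eqxx.
  rewrite addnS => ink ne.
  have [e|e] := eqVneq (b i \in B1) (b (i + n)%N \in B1); last exact: IH (ltnW ink) e.
  by exists (i + n)%N => //; rewrite -e.
have [i ik pi] := ex p pS; have [j jk qj] := ex q qS.
have [n nk ne] : exists2 j, (j.+1 < k)%N & (b j \in B1) != (b j.+1 \in B1).
  have b1 : b i \in B1 by rewrite -pi.
  have b2 : (b j \in B1) = false.
    by apply/negbTE/negP => h; apply: (noboth (b j)) => //; rewrite -qj.
  have [le|le] := leqP i j.
    by apply: (key i (j - i)%N); rewrite subnKC // b1 b2.
  by apply: (key j (i - j)%N); rewrite subnKC ?(ltnW le) // b1 b2.
have e : share_edge (b n) (b n.+1).
  by case: (st n nk) => [->|e]; [constructor 1 | constructor 4].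
have e' : share_edge (b n.+1) (b n).
  by case: (st n nk) => [->|e']; [constructor 2 | constructor 3].
have := in12 n (ltnW nk); have := in12 _ nk; move: ne.
case h1: (b n \in B1); case h2: (b n.+1 \in B1) => //= _ h3 h4.
  by exists (b n), (b n.+1).
by exists (b n.+1), (b n).
Qed.

Lemma path_stair : G_stair k S.
Proof.
split; last exact: path_card.
split; [exact: path_skew | exact: path_connected |].
move=> m n mS; apply/negP => mS'.
have : (m, n) = (m.+1, n.+1) by apply: path_diag_inj => //; rewrite /diag /=; lia.
by case=> /eqP; lia.
Qed.

Lemma path_right i : (i < k)%N -> right_of (b i) \in S ->
  (i.+1 < k)%N /\ b i.+1 = right_of (b i).
Proof.
move=> ik rS; have [j jk [rj dj]] := path_diagP rS.
suff e : j = i.+1 by rewrite -e.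
by move: dj; rewrite diag_right (path_diag ik); lia.
Qed.

Lemma path_above i : (i < k)%N -> above (b i) \in S ->
  (0 < i)%N /\ b i.-1 = above (b i).
Proof.
move=> ik rS; have [j jk [rj dj]] := path_diagP rS.
have ij : j = i.-1 /\ (0 < i)%N by move: dj; rewrite diag_above (path_diag ik); lia.
by case: ij rj => <- ->.
Qed.

Lemma path_step i : (i.+1 < k)%N -> (right_of (b i) == b i.+1) = ~~ (above (b i.+1) == b i).
Proof.
case: Sb => _ _ st ik; case: (st i ik) => ->; rewrite eqxx.
  by apply/esym/eqP; case: (b i) => x y [] /eqP; lia.
by apply/negbTE/eqP; case: (b i.+1) => x y [] /eqP; lia.
Qed.

Lemma path_col i : (i < k)%N ->
  (b i).1 = ((b 0).1 + \sum_(0 <= j < i) (right_of (b j) == b j.+1))%N.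
Proof.
elim: i => [|i IH] ik; first by rewrite big_geq // addn0.
rewrite big_nat_recr //= addnA -IH ?(ltnW ik) //.
case: Sb => _ _ st; have [/eqP <-|] := boolP (right_of (b i) == b i.+1).
  by rewrite /= addn1.
by case: (st i ik) => [->|->]; rewrite ?eqxx //= addn0.
Qed.

Lemma path_width : (0 < k)%N ->
  width S = (\sum_(0 <= j < k.-1) (right_of (b j) == b j.+1)).+1%N.
Proof.
move=> k0; case: (Sb) => mem ex st.
have kk : (k.-1 < k)%N by lia.
have := path_col kk => ck.
apply/eqP; rewrite eqn_leq; apply/andP; split.
  apply/bigmax_leqP_seq => p pS _; apply/bigmax_leqP_seq => q qS _.
  have [i ik [pi _]] := path_diagP pS; have [j jk [qj _]] := path_diagP qS.
  have ik1 : (i <= k.-1)%N by lia.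
  have /andP[m1 _] := path_mono ik1 kk; have /andP[m2 _] := path_mono (leq0n j) jk.
  by rewrite pi qj ltnS leq_subLR; apply: leq_trans m1 _; rewrite ck leq_add2r.
apply: (@leq_trans (\max_(q <- S) ((b k.-1).1 - q.1).+1)%N); last first.
  apply: (leq_bigmax_seq (F := fun p : box => \max_(q <- S) (p.1 - q.1).+1) (b k.-1))%N => //.
  exact: mem.
apply: (@leq_trans ((b k.-1).1 - (b 0%N).1).+1%N); last first.
  apply: (leq_bigmax_seq (F := fun q : box => ((b k.-1).1 - q.1).+1) (b 0))%N => //.
  exact: mem.
by rewrite ck; lia.
Qed.

End Path.

(** Skewness gives convexity, so two boxes on one diagonal would force a forbidden box [(m+1, n+1)];
    connectedness leaves no diagonal out. Sorting by diagonal is therefore the required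
    enumeration. *)
Lemma stair_path k S : G_stair k S -> exists b, is_path S k b.
Proof.
case=> [[[A1 [A2 [f1 f2 SE]]] con nod] cS].
have convex (p q r : box) : p \in S -> q \in S ->
    (p.1 <= r.1 <= q.1)%N -> (p.2 <= r.2 <= q.2)%N -> r \in S.
  rewrite SE !in_fsetD => /andP[pA2 pA1] /andP[qA2 qA1] h1 h2; apply/andP; split.
    have := f2 _ (r.1 - p.1, r.2 - p.2)%N pA2; rewrite /= !subnKC; try lia.
    by case: (r).
  apply: contraLR qA1 => r1; have := f1 _ (q.1 - r.1, q.2 - r.2)%N r1; rewrite /= !subnKC; try lia.
  by case: (q).
have inj (p q : box) : p \in S -> q \in S -> diag p = diag q -> p = q.
  wlog le : p q / (p.1 <= q.1)%N.
    by move=> H pS qS e; have [l|/ltnW l] := leqP p.1 q.1; [|apply/esym]; apply: H.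
  move=> pS qS; case: p q le pS qS => a b [c d] /= le pS qS; rewrite /diag /= => e.
  have [ac|ne] := eqVneq a c; first by (congr (_, _); lia).
  have h := nod a b pS; case/negP: h.
  by apply: (convex (a, b) (c, d)) => //=; lia.
(* Connectedness is applied to the parts of [S] on the two sides of the diagonal [n]; an edge
   changes the diagonal by one, so it joins [n] to [n + 1]. *)
have jump (n : int) (p q : box) : p \in S -> q \in S -> diag p <= n -> n < diag q ->
    exists p' q' : box, [/\ p' \in S, q' \in S, diag p' = n, diag q' = n + 1 & share_edge p' q'].
  move=> pS qS pn nq.
  have [||||p' [q' []]] := con [fset r in S | diag r <= n]%fset [fset r in S | ~~ (diag r <= n)]%fset.
  - by apply/fset0Pn; exists p; rewrite !inE pS.
  - by apply/fset0Pn; exists q; rewrite !inE qS /= -ltNge.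
  - by apply/fsetP => r; rewrite !inE; case: (r \in S); case: (diag r <= n).
  - by apply/fsetP => r; rewrite !inE; case: (r \in S); case: (diag r <= n).
  rewrite !inE => /andP[p'S p'n] /andP[q'S q'n] sh.
  exists p', q'; rewrite p'S q'S.
  have [-> ->] : diag p' = n /\ diag q' = n + 1.
    by case: (sh) => e; move: p'n q'n; rewrite e ?diag_right ?diag_above; lia.
  by [].
pose r : rel box := fun p q => diag p <= diag q.
pose s := sort r (enum_fset S).
have rt : transitive r by move=> a b c; rewrite /r; lia.
have sS : sorted r s by apply: sort_sorted => a b; rewrite /r; lia.
have szs : size s = k by rewrite size_sort -cS.
have us : uniq s by rewrite sort_uniq fset_uniq.
have ms p : (p \in s) = (p \in S) by rewrite mem_sort.
have lt i j : (i < j)%N -> (j < k)%N -> diag (nth (0, 0)%N s i) < diag (nth (0, 0)%N s j).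
  move=> ij jk; rewrite lt_neqAle; apply/andP; split; last first.
    by apply: (sorted_ltn_nth rt) => //; rewrite inE szs; lia.
  apply/eqP => /inj; rewrite -!ms !mem_nth ?szs //; try lia.
  by move=> /(_ isT isT)/eqP; rewrite nth_uniq ?szs //; lia.
exists (nth (0, 0)%N s); split.
- by move=> i ik; rewrite -ms mem_nth // szs.
- by move=> p; rewrite -ms => ps; exists (index p s); rewrite ?nth_index // -szs index_mem.
move=> i ik; set p := nth _ s i; set q := nth _ s i.+1.
have pS : p \in S by rewrite -ms mem_nth // szs; lia.
have qS : q \in S by rewrite -ms mem_nth // szs; lia.
have pq : diag p < diag q by apply: lt.
have [p' [q' [p'S q'S dp' dq' sh]]] := jump (diag p) p q pS qS (lexx _) pq.
have e1 : p' = p by apply: inj.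
have e2 : q' = q.
  apply: inj => //; have q's : q' \in s by rewrite ms.
  have q'j := nth_index (0, 0)%N q's; have jk : (index q' s < k)%N by rewrite -szs index_mem.
  move: (index q' s) q'j jk => j q'j jk.
  have ij : (i < j)%N.
    by rewrite ltnNge; apply/negP; rewrite leq_eqVlt => /orP[/eqP ji|ji];
       [move: dq'; rewrite -q'j ji -/p | have := lt _ _ ji (ltnW ik); rewrite q'j -/p]; lia.
  suff : diag q <= diag q' by lia.
  move: ij; rewrite leq_eqVlt => /orP[/eqP ij|ij]; first by rewrite -q'j -ij.
  by have := lt _ _ ij jk; rewrite q'j -/q; lia.
rewrite e1 e2 in sh dq'; case: sh => [e|e|e|e]; [by left | | | by right].
- by move: pq; rewrite e diag_right; lia.
- by move: pq; rewrite e diag_above; lia.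
Qed.

(** The row is a truncated subtraction; the conditions [n < y0] below keep the walk inside the
    quadrant, where it is exact. *)
Definition walk (x0 y0 : nat) (w : nat -> bool) (n : nat) : box :=
  (x0 + \sum_(0 <= i < n) w i, y0 - \sum_(0 <= i < n) ~~ w i)%N.

Lemma walk_bound (w : nat -> bool) n : (\sum_(0 <= i < n) ~~ w i <= n)%N.
Proof.
rewrite -[X in (_ <= X)%N]subn0 -[X in (_ <= X)%N]mul1n mulnC -sum_nat_const_nat.
by apply: leq_sum => i _; case: (w i).
Qed.

Lemma walk_right x0 y0 (w : nat -> bool) n : w n -> walk x0 y0 w n.+1 = right_of (walk x0 y0 w n).
Proof. by move=> wn; rewrite /walk !big_nat_recr //= wn addn0 addn1 addnS. Qed.

Lemma walk_down x0 y0 (w : nat -> bool) n : (n < y0)%N -> ~~ w n ->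
  walk x0 y0 w n = above (walk x0 y0 w n.+1).
Proof.
move=> ny wn; rewrite /walk !big_nat_recr //= (negbTE wn) addn0 addn1; congr (_, _).
by have /= := walk_bound w n; lia.
Qed.

Lemma walk_step x0 y0 (w : nat -> bool) n : (n < y0)%N ->
  walk x0 y0 w n.+1 = right_of (walk x0 y0 w n) \/ walk x0 y0 w n = above (walk x0 y0 w n.+1).
Proof.
by move=> ny; case: (boolP (w n)) => wn; [left; apply: walk_right | right; apply: walk_down].
Qed.

Lemma walk_rightE x0 y0 (w : nat -> bool) n : (n < y0)%N ->
  (right_of (walk x0 y0 w n) == walk x0 y0 w n.+1) = w n.
Proof.
move=> ny; case: (boolP (w n)) => wn; first by rewrite walk_right // eqxx.
rewrite [in X in X == _]walk_down //; apply/negbTE/eqP; case: (walk _ _ _ _) => x y [] /eqP; lia.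
Qed.

Definition segment (b : nat -> box) (a m : nat) : {fset box} :=
  [fset b i | i in iota a m]%fset.

Lemma segmentP b a m p :
  reflect (exists2 i, (a <= i < a + m)%N & p = b i) (p \in segment b a m).
Proof.
apply: (iffP (imfsetP _ _ _ _)) => [[i /= iam ->]|[i iam ->]]; exists i => //.
  by rewrite mem_iota in iam.
by rewrite /= mem_iota.
Qed.

Lemma segment_path b a m n :
  (forall i, (i < n)%N -> b i.+1 = right_of (b i) \/ b i = above (b i.+1)) ->
  (a + m <= n.+1)%N -> is_path (segment b a m) m (fun i => b (a + i)%N).
Proof.
move=> st amn; split=> [i im|p /segmentP[i iam ->]|i im].
- by apply/segmentP; exists (a + i)%N => //; lia.
- by exists (i - a)%N; [lia | congr b; lia].
- by rewrite addnS; apply: st; lia.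
Qed.

Lemma generatorsP S p : reflect
  (p \in S /\ forall q, q \in S -> p <> right_of q /\ p <> above q) (p \in generators S).
Proof.
rewrite !inE /=; apply: (iffP andP) => -[pS h]; split=> //.
  by move=> q qS; move/forallP/(_ [` qS]%fset): h => /= /andP[/eqP h1 /eqP h2].
by apply/forallP => q; have [/eqP h1 /eqP h2] := h _ (valP q); apply/andP.
Qed.

(** * Translations and gluing of stairs *)

Lemma same_abstract_sym k S T : same_abstract k S T -> same_abstract k T S.
Proof. by case=> a [b [e m]]; exists b, a; split; apply: esym. Qed.

Lemma same_abstract_diag k S T : same_abstract k S T ->
  exists v : int, forall p, p \in S -> exists2 p', p' \in T & diag p' = diag p + v.
Proof.
case=> a [b [/fsetP e _]]; exists (diag a - diag b) => p pS.
have : (p.1 + a.1, p.2 + a.2)%N \in [fset (p.1 + a.1, p.2 + a.2)%N | p in S]%fset.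
  by apply/imfsetP; exists p.
rewrite e => /imfsetP[p' /= p'T [e1 e2]]; exists p' => //.
by move: e1 e2; rewrite /diag; lia.
Qed.

(** One shift [v] serves all generators, so differences of their diagonals do not depend on the
    realization. *)
Lemma same_abstract_generators k S T : same_abstract k S T ->
  exists v : int, forall p, p \in generators S ->
    exists2 p', p' \in generators T & diag p' = diag p + v.
Proof.
case=> a [b [/fsetP e _]]; exists (diag a - diag b) => p /generatorsP[pS pg].
have : (p.1 + a.1, p.2 + a.2)%N \in [fset (p.1 + a.1, p.2 + a.2)%N | p in S]%fset.
  by apply/imfsetP; exists p.
rewrite e => /imfsetP[p' /= p'T [e1 e2]]; exists p'; last first.
  by move: e1 e2; rewrite /diag; lia.
apply/generatorsP; split=> // q' q'T.
have : (q'.1 + b.1, q'.2 + b.2)%N \in [fset (p.1 + b.1, p.2 + b.2)%N | p in T]%fset.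
  by apply/imfsetP; exists q'.
rewrite -e => /imfsetP[q /= qS [e3 e4]]; have [h1 h2] := pg q qS.
case: p q p' q' {pS pg p'T qS q'T e} e1 e2 e3 e4 h1 h2 => [x y] [u v] [x' y'] [u' v'] /=.
rewrite /right_of /above /= => e1 e2 e3 e4 h1 h2.
by split=> -[e5 e6]; [apply: h1|apply: h2]; congr (_, _); lia.
Qed.

(** The second copy occupies diagonals from [diag (b 0) + k] on, beyond all of [S]. Hence a box of
    [S'] on a diagonal of [S] lies in [S] itself, and the nonempty overlap keeps the start of [S']
    within one period. *)
Lemma consecutive_starts k S S' b b' : (0 < k)%N -> is_path S k b -> is_path S' k b' ->
  consecutive k S S' ->
  (diag (b 0%N) <= diag (b' 0%N) < diag (b 0%N) + k%:Z) /\
  (forall p p', p \in S -> p' \in S' -> diag p = diag p' -> p = p').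
Proof.
move=> k0 Sb Sb' [S2 [_ [pl [[plS plmax] [_ S2min]]] sub /fset0Pn[r rSS'] _]].
have kk : (k.-1 < k)%N by lia.
have dpl : diag pl = diag (b 0%N) + k%:Z - 1.
  have [i ik [_ di]] := path_diagP Sb plS.
  have bS : b k.-1 \in S by case: Sb => mem _ _; apply: mem.
  have := plmax _ bS; have := path_diag Sb kk; rewrite /before /diag in di *; lia.
have dS2 q : q \in S2 -> diag (b 0%N) + k%:Z <= diag q.
  move/S2min; rewrite /before /right_of /= => h; move: dpl; rewrite /diag; lia.
split.
  have b'S' : b' 0%N \in S' by case: Sb' => mem _ _; apply: mem.
  have := fsubsetP sub _ b'S'; rewrite inE => /orP h.
  apply/andP; split.
    by case: h => [/(path_diagP Sb)[i ik [_ ->]]|/dS2]; lia.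
  move: rSS'; rewrite inE => /andP[/(path_diagP Sb)[i ik [_ di]] /(path_diagP Sb')[j jk [_ dj]]].
  by lia.
move=> p p' pS p'S' e; have := fsubsetP sub _ p'S'; rewrite inE => /orP[p'S|/dS2].
  exact: (path_diag_inj Sb).
by have [i ik [_ di]] := path_diagP Sb pS; lia.
Qed.

(** * Partial sums of a stability condition *)

Lemma increasing_between disp (T : porderType disp) (v : nat -> T) (k i j : nat) :
  (forall l, (0 < l < k)%N -> (v l < v l.+1)%O) -> (0 < i)%N -> (i < j <= k)%N -> (v i < v j)%O.
Proof.
move=> vS i0; elim: j => [|j IH] ij; first by lia.
have h : (v j < v j.+1)%O by apply: vS; lia.
have [->//|ne] := eqVneq i j.
by apply: lt_trans h; apply: IH; lia.
Qed.

Section Residues.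
Variables (k : nat) (k0 : (0 < k)%N).

Fact resid_subproof (z : int) : (`|(z %% k)%Z| < k)%N.
Proof. by have := ltz_pmod z (d := k); have := modz_ge0 z (d := k); lia. Qed.

Definition resid (z : int) : 'I_k := Ordinal (resid_subproof z).

Lemma resid_eq (a b : int) : (resid a = resid b) <-> (exists q : int, a = b + q * k%:Z).
Proof.
split=> [[e]|[q ->]]; last by apply: val_inj => /=; rewrite addrC modzMDl.
have ha := modz_ge0 a (d := k); have hb := modz_ge0 b (d := k).
have da := divz_eq a k; have db := divz_eq b k.
by exists ((a %/ k)%Z - (b %/ k)%Z); lia.
Qed.

Lemma resid_nat (i : 'I_k) : resid (i : nat)%:Z = i.
Proof. by apply: val_inj => /=; rewrite modz_nat absz_nat modn_small. Qed.

Definition periodic T (f : int -> T) : Prop := forall z, f (z + k%:Z) = f z.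

Lemma periodic_resid T (f : int -> T) a b : periodic f -> resid a = resid b -> f a = f b.
Proof.
move=> fp /resid_eq[q ->].
have pos c (n : nat) : f (c + n%:Z * k%:Z) = f c.
  elim: n => [|n IH]; first by congr f; lia.
  by rewrite -[RHS]IH -(fp (c + n%:Z * k%:Z)); congr f; lia.
case: q => n; first exact: pos.
by rewrite -(pos (b + _) n.+1); rewrite NegzE mulNr addrNK.
Qed.

Lemma residS z : resid (z + 1) = (if (resid z).+1 == k then 0 else (resid z).+1) :> nat.
Proof.
have hb := modz_ge0 (z + 1) (d := k); have db := divz_eq (z + 1) k; have lb := resid_subproof (z + 1).
have ha := modz_ge0 z (d := k); have da := divz_eq z k; have la := resid_subproof z.
have [q e] := (resid_eq _ _).1 (resid_nat (resid (z + 1))).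
have [q' e'] := (resid_eq _ _).1 (resid_nat (resid z)).
move: (ltn_ord (resid (z + 1))) (ltn_ord (resid z)) e e'.
move: (nat_of_ord (resid (z + 1))) (nat_of_ord (resid z)) => m n mk nk e e'.
case: eqP => nE; last first.
  suff : q = q' by move=> E; rewrite E in e; lia.
  by clear - mk nk e e' nE; nia.
suff : q = q' - 1 by move=> E; rewrite E in e; nia.
by clear - mk nk e e' nE; nia.
Qed.

Lemma resid_surj d (z : int) : exists2 i, (i < k)%N & resid (d + i%:Z) = resid z.
Proof.
exists (resid (z - d)); first exact: ltn_ord.
apply/resid_eq; exists (- ((z - d) %/ k)%Z) => /=.
have hb := modz_ge0 (z - d) (d := k); have db := divz_eq (z - d) k; lia.
Qed.

Lemma resid_inj d i j : (i < k)%N -> (j < k)%N ->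
  resid (d + i%:Z) = resid (d + j%:Z) -> i = j.
Proof.
move=> ik jk /resid_eq[q e]; suff : q = 0 by move=> q0; rewrite q0 in e; lia.
nia.
Qed.

Lemma sum_period (V : nmodType) (f : int -> V) (d : int) : periodic f ->
  \sum_(i < k) f (i : nat)%:Z = \sum_(0 <= i < k) f (d + i%:Z).
Proof.
move=> fp; rewrite big_mkord.
have inj : injective (fun i : 'I_k => resid (d + (i : nat)%:Z)).
  by move=> i j e; apply: val_inj; apply: (resid_inj _ _ e).
rewrite (reindex_inj inj); apply: eq_bigr => i _.
by apply: (periodic_resid fp); apply: resid_nat.
Qed.

(* The walls of the space of stability conditions are the equalities between
   two values of [psum th]. *)
Definition psum (th : {ffun 'I_k -> rat}) (z : int) : rat :=
  \sum_(0 <= i < `|(z %% k)%Z|) th (resid i%:Z).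

Lemma psum_periodic th : periodic (psum th).
Proof. by move=> z; rewrite /psum modzDr. Qed.

(** [psum] is periodic by construction; the vanishing of the total is what makes the increment right
    at the wrap from [k - 1] to 0. *)
Lemma psumS (th : {ffun 'I_k -> rat}) z : \sum_i th i = 0 ->
  psum th (z + 1) = psum th z + th (resid z).
Proof.
move=> s0; rewrite /psum.
have -> : th (resid z) = th (resid `|(z %% k)%Z|%:Z).
  by congr (th _); apply: val_inj; rewrite /= modz_nat absz_nat modn_small // resid_subproof.
rewrite -big_nat_recr //=.
have ha := modz_ge0 z (d := k); have da := divz_eq z k; have la := resid_subproof z.
have [e|e] := eqVneq `|(z %% k)%Z|.+1 k.
  have -> : ((z + 1) %% k)%Z = 0.
    by apply/dvdz_mod0P; apply/dvdzP; exists ((z %/ k)%Z + 1); lia.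
  rewrite e big_geq // -[LHS]s0 big_mkord; apply: eq_bigr => i _.
  by rewrite resid_nat.
suff -> : ((z + 1) %% k)%Z = `|(z %% k)%Z|.+1 :> int by [].
have hb := modz_ge0 (z + 1) (d := k); have db := divz_eq (z + 1) k; have lb := resid_subproof (z + 1).
suff : ((z + 1) %/ k)%Z = (z %/ k)%Z by move=> E; rewrite E in db; lia.
nia.
Qed.

Definition separated (s : int -> rat) : Prop :=
  forall a b, s a = s b -> resid a = resid b.

Definition rank (s : int -> rat) (z : int) : nat := (\sum_(i < k) (s (i : nat)%:Z < s z)%R)%N.

Lemma rank_mono s a b : s a <= s b -> (rank s a <= rank s b)%N.
Proof.
move=> ab; apply: leq_sum => i _.
by case h : (s _ < s a) => //; rewrite (lt_le_trans h ab).
Qed.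

Lemma rank_lt_mono s a b : periodic s -> s a < s b -> (rank s a < rank s b)%N.
Proof.
move=> sp ab; rewrite /rank (bigD1 (resid a)) //= [X in (_ < X)%N](bigD1 (resid a)) //=.
have e : s (resid a : nat)%:Z = s a by apply: (periodic_resid sp); apply: resid_nat.
rewrite e ltxx ab add0n add1n ltnS; apply: leq_sum => i _.
by case h : (s _ < s a) => //; rewrite (lt_trans h ab).
Qed.

Lemma rank_bound s a : periodic s -> (rank s a < k)%N.
Proof.
move=> sp; rewrite /rank (bigD1 (resid a)) //=.
have e : s (resid a : nat)%:Z = s a by apply: (periodic_resid sp); apply: resid_nat.
rewrite e ltxx add0n.
have := cardC1 (resid a); rewrite card_ord => c.
apply: (@leq_ltn_trans (\sum_(i in predC1 (resid a)) 1)%N); last by rewrite sum1_card c; lia.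
by apply: leq_sum => i _; case: (_ < _).
Qed.

Lemma rank_eq s a b : periodic s -> separated s -> rank s a = rank s b -> resid a = resid b.
Proof.
move=> sp ss e; apply: ss.
by have [/(rank_lt_mono sp)|/(rank_lt_mono sp)|//] := ltgtP (s a) (s b); rewrite e ltnn.
Qed.

End Residues.

Lemma abel_sum (R : comPzRingType) (f g : nat -> R) n : f 0%N = 0 ->
  \sum_(0 <= i < n.+1) (f i.+1 - f i) * g i
  = f n.+1 * g n + \sum_(0 <= i < n) f i.+1 * (g i - g i.+1).
Proof.
move=> f0; elim: n => [|n IH].
  by rewrite big_nat1 big_geq // f0 subr0 addr0.
by rewrite big_nat_recr // IH /= [in RHS]big_nat_recr //=; ring.
Qed.

(* [h] is the set of boxes of a subsheaf of a stair; after summation by parts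
   every term is nonnegative because the subsheaf is closed under the arrows. *)
Lemma arrows_sum_ge0 (f : nat -> rat) (h : nat -> bool) n :
  f 0%N = 0 -> f n.+1 = 0 ->
  (forall i, (i < n)%N -> f i.+1 < 0 -> h i -> h i.+1) ->
  (forall i, (i < n)%N -> 0 < f i.+1 -> h i.+1 -> h i) ->
  0 <= \sum_(0 <= i < n.+1) (f i.+1 - f i) *+ h i
  /\ ((forall i, (i < n)%N -> f i.+1 != 0) ->
      (exists2 i, (i < n)%N & h i != h i.+1) ->
      0 < \sum_(0 <= i < n.+1) (f i.+1 - f i) *+ h i).
Proof.
move=> f0 fn hneg hpos.
have -> : \sum_(0 <= i < n.+1) (f i.+1 - f i) *+ h i
   = \sum_(0 <= i < n) f i.+1 * ((h i)%:R - (h i.+1)%:R).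
  under eq_bigr do rewrite -mulr_natr.
  by rewrite (abel_sum (fun i => (h i)%:R)) // fn mul0r add0r.
have term i : (i < n)%N -> 0 <= f i.+1 * ((h i)%:R - (h i.+1)%:R).
  move=> ilt; have := hneg i ilt; have := hpos i ilt.
  by case: (ltgtP (f i.+1) 0) => [s|s|->]; case: (h i); case: (h i.+1) => //=;
    rewrite ?subrr ?mulr0 ?mul0r // ?subr0 ?sub0r ?mulr1 ?mulrN1 ?oppr_ge0 => H H';
    move: (H) (H'); do ?[move=> /(_ isT isT)] => *;
    try lra; try (by have := H isT isT); by have := H' isT isT.
split; first by rewrite big_nat_cond; apply: sumr_ge0 => i; rewrite andbT => /andP[_ /term].
move=> nz [i ilt hi].
rewrite big_mkord (bigD1 (Ordinal ilt)) //=; apply: ltr_pwDl; last first.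
  by apply: sumr_ge0 => j _; exact: term.
rewrite lt_neqAle term // andbT eq_sym mulf_neq0 // ?nz //.
by move: hi; case: (h i); case: (h i.+1) => // _; rewrite ?subr0 ?sub0r ?oppr_eq0 oner_eq0.
Qed.

(** * Cyclic orders with at most two turns *)

Section Orders.
Variables (k : nat) (k0 : (0 < k)%N) (k1 : (1 < k)%N).

(* Label [c + i], [c] being the first label of the chamber stair, starts a stair
   of the chamber at position [turn_pos B i] of the chamber stair: on the first
   turn around the labels, or on the second one if [i] belongs to the subset [B]
   of [1, .., k - 2]. *)
Definition second_turn (B : {ffun 'I_(k - 2) -> bool}) (i : nat) : bool :=
  (0 < i)%N && (if insub i.-1 is Some j then B j else false).

Definition turn_pos (B : {ffun 'I_(k - 2) -> bool}) (i : nat) : nat :=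
  (i + k * second_turn B i)%N.

Lemma second_turn0 B : second_turn B 0 = false.
Proof. by []. Qed.

Lemma second_turn_last B : second_turn B k.-1 = false.
Proof. by rewrite /second_turn insubF ?andbF //; lia. Qed.

Lemma second_turnS B (j : 'I_(k - 2)) : second_turn B j.+1 = B j.
Proof. by rewrite /second_turn /= valK. Qed.

Lemma turn_pos_inj B i j : (i < k)%N -> (j < k)%N -> turn_pos B i = turn_pos B j -> i = j.
Proof. by rewrite /turn_pos; case: second_turn; case: second_turn; lia. Qed.

(** The only offset that could reach [2k - 1] is [k - 1], and it never belongs to the second
    turn. *)
Lemma turn_pos_bound B i : (i < k)%N -> (turn_pos B i < k.*2.-1)%N.
Proof.
move=> ik; rewrite /turn_pos; have [e|e] := eqVneq i k.-1.
  by rewrite e second_turn_last; lia.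
by case: second_turn; lia.
Qed.

(** Offset [k - 1] closes the first turn, so comparison with it tells the turns apart; this recovers
    [B] from the order alone. *)
Lemma second_turnE B i : (i < k)%N -> second_turn B i = (turn_pos B k.-1 < turn_pos B i)%N.
Proof. by move=> ik; rewrite /turn_pos second_turn_last; case: second_turn; lia. Qed.

Definition ordered (c : 'I_k) (B : {ffun 'I_(k - 2) -> bool}) (s : int -> rat) : Prop :=
  forall i j, (i < k)%N -> (j < k)%N -> (turn_pos B i < turn_pos B j)%N ->
    s ((c : nat)%:Z + i%:Z) < s ((c : nat)%:Z + j%:Z).

Lemma orderedE c B s i j : ordered c B s -> (i < k)%N -> (j < k)%N ->
  (s ((c : nat)%:Z + i%:Z) < s ((c : nat)%:Z + j%:Z)) = (turn_pos B i < turn_pos B j)%N.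
Proof.
move=> o ik jk; have [l|l|e] := ltngtP (turn_pos B i) (turn_pos B j).
- exact: o.
- by apply/negbTE; rewrite -leNgt ltW // o.
- by rewrite (turn_pos_inj ik jk e) ltxx.
Qed.

Lemma ordered_separated c B s : periodic k s -> ordered c B s -> separated k0 s.
Proof.
move=> sp o a b e.
have [i ik ra] := resid_surj k0 (c : nat)%:Z a.
have [j jk rb] := resid_surj k0 (c : nat)%:Z b.
rewrite -ra -rb; suff -> : i = j by [].
rewrite -(periodic_resid sp ra) -(periodic_resid sp rb) in e.
have := orderedE o ik jk; have := orderedE o jk ik; rewrite e ltxx.
move=> /esym/negbT; rewrite -leqNgt => h1 /esym/negbT; rewrite -leqNgt => h2.
by apply: (@turn_pos_inj B) => //; apply/eqP; rewrite eqn_leq h1 h2.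
Qed.

Definition same_order (s s' : int -> rat) : Prop := forall a b, (s a < s b) = (s' a < s' b).

Lemma ordered_same c B s s' : periodic k s -> periodic k s' ->
  ordered c B s -> ordered c B s' -> same_order s s'.
Proof.
move=> sp sp' o o' a b.
have [i ik ra] := resid_surj k0 (c : nat)%:Z a.
have [j jk rb] := resid_surj k0 (c : nat)%:Z b.
by rewrite -(periodic_resid sp ra) -(periodic_resid sp rb)
  -(periodic_resid sp' ra) -(periodic_resid sp' rb) (orderedE o) // (orderedE o').
Qed.

Lemma same_ordered c B s s' : same_order s s' -> ordered c B s -> ordered c B s'.
Proof. by move=> ss o i j ik jk lt; rewrite -ss; apply: o. Qed.

Lemma ordered_inj c c' B B' s : periodic k s ->
  ordered c B s -> ordered c' B' s -> c = c' /\ B = B'.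
Proof.
move=> sp o o'.
have le0 c1 B1 : ordered c1 B1 s -> forall z, s (c1 : nat)%:Z <= s z.
  move=> o1 z; have [i ik /(periodic_resid sp) <-] := resid_surj k0 (c1 : nat)%:Z z.
  rewrite leNgt -[X in _ < s X]addr0 (orderedE (j := 0) o1) //.
  by rewrite /turn_pos second_turn0 muln0 addn0 ltn0.
have cc : c = c'.
  have e : s (c : nat)%:Z = s (c' : nat)%:Z by apply/eqP; rewrite eq_le (le0 _ _ o) (le0 _ _ o').
  by have := ordered_separated sp o e; rewrite !resid_nat.
split=> //; rewrite -cc in o'; apply/ffunP => j.
have jk : (j.+1 < k)%N by have := ltn_ord j; lia.
have kk : (k.-1 < k)%N by lia.
by rewrite -!second_turnS !second_turnE // -(orderedE o) // -(orderedE o').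
Qed.

(** The partial sums are prescribed first, as the positions [turn_pos], and [th] is their
    difference. Periodicity makes its total telescope to zero, and [psum] differs from the
    prescribed values by a constant. *)
Lemma ordered_exists c B : exists th : {ffun 'I_k -> rat},
  \sum_i th i = 0 /\ ordered c B (psum k0 th).
Proof.
pose f (z : int) : rat := (turn_pos B (resid k0 (z - (c : nat)%:Z)))%:R.
have fp : periodic k f.
  by move=> z; rewrite /f; congr (turn_pos B (nat_of_ord _))%:R; apply/resid_eq; exists 1; lia.
pose th : {ffun 'I_k -> rat} := [ffun i : 'I_k => f ((i : nat)%:Z + 1) - f (i : nat)%:Z].
have S0 : \sum_i th i = 0.
  under eq_bigr do rewrite ffunE.
  have := telescope_sumr (fun i => f i%:Z) (leq0n k).
  rewrite big_mkord -[X in f X - _]add0r fp subrr => E; rewrite -[RHS]E.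
  by apply: eq_bigr => i _; congr (f _ - _); lia.
exists th; split=> //.
have psE z : psum k0 th z = f z - f 0.
  have -> : f z = f `|(z %% k)%Z|%:Z.
    apply: (periodic_resid fp (k0 := k0)); apply: val_inj => /=.
    by rewrite modz_nat absz_nat modn_small // resid_subproof.
  rewrite -(telescope_sumr (fun i => f i%:Z)) // /psum !big_mkord.
  apply: eq_bigr => i _; rewrite ffunE.
  have -> : nat_of_ord (resid k0 (i : nat)%:Z) = i.
    by rewrite /= modz_nat absz_nat modn_small // (ltn_trans (ltn_ord i)) // resid_subproof.
  by congr (f _ - _); lia.
have fE i : (i < k)%N -> f ((c : nat)%:Z + i%:Z) = (turn_pos B i)%:R.
  move=> ik; rewrite /f; congr (turn_pos B _)%:R.
  by rewrite -[RHS](congr1 (@nat_of_ord k) (resid_nat k0 (Ordinal ik)));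
     congr (nat_of_ord (resid _ _)) => /=; lia.
by move=> i j ik jk lt; rewrite !psE !fE // ltrD2r ltr_nat.
Qed.

(* [d j] is the position of the first box of the stair of width [j], the
   positions being labels lifted to the integers along the glued stair. *)
Lemma short_ordered (s : int -> rat) (d : nat -> int) : periodic k s -> separated k0 s ->
  (forall j, (0 < j <= k)%N -> rank k s (d j) = j.-1) ->
  (forall j, (0 < j < k)%N -> d j < d j.+1) ->
  d k < d 1%N + (k.*2.-1)%:Z ->
  exists c B, ordered c B s.
Proof.
move=> sp ss rk dS dk.
have dlt a b : (0 < a)%N -> (a < b <= k)%N -> d a < d b by exact: increasing_between.
have slt a b : (0 < a <= k)%N -> (0 < b <= k)%N -> (s (d a) < s (d b)) = (d a < d b).
  move=> ha hb; have ra := rk a ha; have rb := rk b hb.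
  have [ab|ab|->] := ltngtP a b; last by rewrite !ltxx.
    rewrite dlt; try lia.
    by rewrite ltNge; apply/negP => /(rank_mono k); lia.
  have := dlt b a; case: (ltgtP (d a) (d b)); try lia.
  by move=> _ _; apply/negbTE/negP => /ltW /(rank_mono k); lia.
have ex i : (i < k)%N -> exists2 a, (0 < a <= k)%N &
    resid k0 (d a) = resid k0 (d 1%N + i%:Z) /\ (d a = d 1%N + i%:Z \/ d a = d 1%N + i%:Z + k%:Z).
  move=> ik; set z := d 1%N + i%:Z.
  have rb := rank_bound k0 z sp.
  have ha : (0 < (rank k s z).+1 <= k)%N by lia.
  have e := rank_eq sp ss (rk _ ha).
  exists (rank k s z).+1 => //; split=> //.
  have [q dq] := (resid_eq k0 _ _).1 e.
  have h1 : d 1%N <= d (rank k s z).+1.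
    by case: (rank k s z) ha => // n hn; rewrite ltW // dlt //.
  have h2 : d (rank k s z).+1 <= d k.
    by have [->//|ne] := eqVneq (rank k s z).+1 k; rewrite ltW // dlt //; lia.
  (* All starts lie in an interval of length less than [2k] from [d 1], so a start exceeds the first
     lift of its label by at most one period. *)
  have : q = 0 \/ q = 1.
    have zE : z = d 1%N + i%:Z by [].
    clearbody z; move: (d (rank k s z).+1) dq h1 h2 => x dq h1 h2.
    have q2 : q * k%:Z < 2 * k%:Z by lia.
    have q1 : (-1) * k%:Z < q * k%:Z by lia.
    by move: q1 q2; rewrite !ltr_pM2r //; lia.
  have zE : z = d 1%N + i%:Z by [].
  by case=> qE; rewrite qE in dq; [left|right]; lia.
pose c := resid k0 (d 1%N).
have sc i : s ((c : nat)%:Z + i%:Z) = s (d 1%N + i%:Z).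
  apply: (periodic_resid sp (k0 := k0)).
  have [q e] := (resid_eq k0 _ _).1 (resid_nat k0 c).
  by apply/resid_eq; exists q; lia.
pose B : {ffun 'I_(k - 2) -> bool} :=
  [ffun j : 'I_(k - 2) => s (d 1%N + k.-1%:Z) < s (d 1%N + (j : nat).+1%:Z)].
(* On the second turn offset [k - 1] would stand at [d 1 + 2k - 1], beyond [d k]. *)
have [a' ha' [ra' da']] : exists2 a, (0 < a <= k)%N &
    resid k0 (d a) = resid k0 (d 1%N + k.-1%:Z) /\ d a = d 1%N + k.-1%:Z.
  have kk : (k.-1 < k)%N by lia.
  have [a ha [ra da]] := ex _ kk; exists a => //; split=> //.
  case: da => // da; have : d a <= d k; last by lia.
  by have [->//|ne] := eqVneq a k; rewrite ltW // dlt //; lia.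
have posE i : (i < k)%N -> exists2 a, (0 < a <= k)%N &
    resid k0 (d a) = resid k0 (d 1%N + i%:Z) /\ d a = d 1%N + (turn_pos B i)%:Z.
  move=> ik; have [a ha [ra da]] := ex i ik; exists a => //; split=> //.
  rewrite /turn_pos; have [i0|i0] := posnP i.
    rewrite i0 second_turn0; case: da => da; first by lia.
    have : s (d a) = s (d 1%N) by rewrite da sp i0 addr0.
    by move=> e; have := slt 1%N a _ ha; rewrite e ltxx; lia.
  have [ik1|ik1] := eqVneq i k.-1.
    rewrite ik1 second_turn_last; case: da => da; first by lia.
    have : s (d a) = s (d a') by rewrite da sp ik1 -da'.
    by move=> e; have := slt a' a ha' ha; rewrite e ltxx; lia.
  have ij : (i.-1 < k - 2)%N by lia.
  have -> : i = (Ordinal ij).+1 by rewrite /=; lia.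
  rewrite second_turnS ffunE /= prednK //.
  rewrite -(periodic_resid sp ra) -(periodic_resid sp ra') slt // da'.
  by case: da => ->; lia.
exists c, B => i j ik jk lt; rewrite !sc.
have [a ha [ra da]] := posE i ik; have [b hb [rb db]] := posE j jk.
by rewrite -(periodic_resid sp ra) -(periodic_resid sp rb) slt // da db; lia.
Qed.

(** Ranking the positions gives an injective self-map of ['I_k]; inverting it lists them in
    increasing order. Gaps stay below [k], so that successive stairs overlap, because position
    [k - 1] is always taken and all positions are below [2k - 1]. *)
Lemma turn_enum B : exists v : nat -> nat,
  [/\ v 1%N = 0%N,
      forall j, (0 < j < k)%N -> (v j < v j.+1 < v j + k)%N,
      forall j, (0 < j <= k)%N -> v j = turn_pos B (v j %% k)%N /\
        (\sum_(i < k) (turn_pos B i < v j) = j.-1)%N,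
      forall i, (i < k)%N -> exists2 j, (0 < j <= k)%N & v j = turn_pos B i
    & forall j, (0 < j <= k)%N -> (v j < k.*2.-1)%N].
Proof.
pose P := turn_pos B.
pose r (i : 'I_k) := (\sum_(i' < k) (P i' < P i))%N.
have rmono (i i' : 'I_k) : (P i < P i')%N -> (r i < r i')%N.
  move=> h; rewrite /r (bigD1 i) //= [X in (_ < X)%N](bigD1 i) //= ltnn h add0n add1n ltnS.
  apply: leq_sum => u _; case h' : (P u < P i)%N => //.
  by rewrite (ltn_trans h' h).
have rk (i : 'I_k) : (r i < k)%N.
  rewrite /r (bigD1 i) //= ltnn add0n.
  have := cardC1 i; rewrite card_ord => c.
  apply: (@leq_ltn_trans (\sum_(i' in predC1 i) 1)%N); last by rewrite sum1_card c; lia.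
  by apply: leq_sum => u _; case: (_ < _)%N.
pose f i : 'I_k := Ordinal (rk i).
have finj : injective f.
  move=> i i' /(congr1 val) e; have {e} : r i = r i' by []; move=> e.
  apply: val_inj; apply: (@turn_pos_inj B _ _ (ltn_ord i) (ltn_ord i')).
  by have [/rmono|/rmono|] := ltngtP (P i) (P i'); rewrite ?e ?ltnn.
pose v j := if insub j.-1 is Some i then P (invF finj i) else 0%N.
have vE j : (0 < j <= k)%N -> exists i : 'I_k, [/\ v j = P i & r i = j.-1].
  move=> jk; have jk' : (j.-1 < k)%N by lia.
  exists (invF finj (Ordinal jk')); rewrite /v insubT; split=> //.
  exact: (congr1 val (f_invF finj (Ordinal jk'))).
have vr (i : 'I_k) : v (r i).+1 = P i.
  have [|i' [-> e]] := vE (r i).+1; first by rewrite rk.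
  by suff -> : i' = i by []; apply: (finj i' i); apply: val_inj.
have vlt j j' : (0 < j <= k)%N -> (0 < j' <= k)%N -> (j < j')%N -> (v j < v j')%N.
  move=> h; have [i [-> ri]] := vE j h; move=> h' jj'; have [i' [-> ri']] := vE j' h'.
  have [//|/rmono|e] := ltngtP (P i) (P i'); first by lia.
  have ii : i = i' :> nat by apply: (turn_pos_inj (ltn_ord i) (ltn_ord i') e).
  by have := congr1 r (val_inj ii); rewrite ri ri'; lia.
have vbound j : (0 < j <= k)%N -> (v j < k.*2.-1)%N.
  by move=> /vE[i [-> _]]; apply: turn_pos_bound.
have ex i : (i < k)%N -> exists2 j, (0 < j <= k)%N & v j = P i.
  by move=> ik; exists (r (Ordinal ik)).+1; [rewrite rk | rewrite vr].
have Plast : P k.-1 = k.-1 by rewrite /P /turn_pos second_turn_last; lia.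
have kk : (k.-1 < k)%N by lia.
exists v; split=> //.
- have [j jk vj] := ex 0%N k0; have [->|ne] := eqVneq 1%N j.
    by rewrite vj /P /turn_pos second_turn0; lia.
  have := vlt 1%N j _ jk; rewrite vj /P /turn_pos second_turn0; lia.
- move=> j jk; rewrite vlt; try lia.
  have [j' j'k vj'] := ex _ kk; rewrite Plast in vj'.
  have [h|h] := ltnP (v j) k.-1.
    have jj' : (j < j')%N.
      rewrite ltnNge; apply/negP; rewrite leq_eqVlt => /orP[/eqP e|/vlt]; last by lia.
      by move: h; rewrite -e vj'; lia.
    have [e|e] := eqVneq j.+1 j'; first by rewrite e vj'; lia.
    by have := vlt j.+1 j'; lia.
  by have := vbound j.+1; lia.
- move=> j /vE[i [-> ri]]; split; last by rewrite -ri.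
  have -> : (P i %% k)%N = i by rewrite /P {1}/turn_pos addnC mulnC modnMDl modn_small.
  by []. 
Qed.

End Orders.

(** * The chamber stair as a walk *)

Section ChamberWalk.
Variables (k : nat) (k0 : (0 < k)%N) (k1 : (1 < k)%N).
Variables (c : 'I_k) (B : {ffun 'I_(k - 2) -> bool}).
Local Notation P := (turn_pos B).

(** [P (n %% k)] is congruent to [n] mod [k], so a strict inequality leaves a whole period; the next
    lemma uses the same remark in the other direction. *)
Lemma turn_pos_late n : (P (n %% k) < n)%N -> (P (n %% k) + k <= n)%N.
Proof.
have := divn_eq n k; move: (n %/ k)%N (n %% k)%N => q r ->.
rewrite /turn_pos; case: (second_turn B r); rewrite ?muln1 ?muln0.
  by case: q => [|[|q]]; rewrite ?mulSn; lia.
by case: q => [|q]; rewrite ?mulSn; lia.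
Qed.

Lemma turn_pos_early n : (n <= P (n %% k) -> P (n %% k) = n \/ n + k <= P (n %% k))%N.
Proof.
have := divn_eq n k; move: (n %/ k)%N (n %% k)%N => q r ->.
rewrite /turn_pos; case: (second_turn B r); rewrite ?muln1 ?muln0.
  by case: q => [|[|q]]; rewrite ?mulSn; lia.
by case: q => [|q]; rewrite ?mulSn; lia.
Qed.

(* A label is entered downwards up to the position where it starts its own stair
   and rightwards afterwards. *)
Definition chamber_step (n : nat) : bool := (P (n.+1 %% k) < n.+1)%N.

(* The initial height [5 * k] leaves room for the whole chamber stair and for a
   second copy of its last window, and keeps the labels unchanged mod [k]. *)
Definition chamber_walk : nat -> box := walk c (5 * k) chamber_step.
Local Notation bK := chamber_walk.

Lemma chamber_walk_step n : (n < 5 * k)%N ->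
  bK n.+1 = right_of (bK n) \/ bK n = above (bK n.+1).
Proof. exact: walk_step. Qed.

Lemma chamber_walkR n : (n < 5 * k)%N -> chamber_step n -> bK n.+1 = right_of (bK n).
Proof. by move=> _; exact: walk_right. Qed.

Lemma chamber_walkD n : (n < 5 * k)%N -> ~~ chamber_step n -> bK n = above (bK n.+1).
Proof. exact: walk_down. Qed.

Lemma chamber_walk_diag n : (n <= 5 * k)%N ->
  diag (bK n) = (c : nat)%:Z - (5 * k)%N%:Z + n%:Z.
Proof.
move=> nk; have p := segment_path (a := 0) chamber_walk_step (leqnn _).
have nk' : (n < (5 * k).+1)%N by [].
have := path_diag p nk'; rewrite !add0n => ->; congr (_ + _).
by rewrite /bK /walk !big_geq // /diag /= addn0 subn0.
Qed.

Lemma chamber_walk_inj m n : (m <= 5 * k)%N -> (n <= 5 * k)%N ->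
  diag (bK m) = diag (bK n) -> m = n.
Proof. by move=> hm hn; rewrite !chamber_walk_diag //; lia. Qed.

Lemma walk_psum (th : {ffun 'I_k -> rat}) n : (n <= 5 * k)%N ->
  psum k0 th (diag (bK n)) = psum k0 th ((c : nat)%:Z + (n %% k)%N%:Z).
Proof.
move=> nk; apply: (periodic_resid (psum_periodic k0 th) (k0 := k0)).
rewrite chamber_walk_diag //; apply/resid_eq; exists ((n %/ k)%N%:Z - 5).
rewrite {1}(divn_eq n k) !PoszD !PoszM; ring.
Qed.

Lemma walk_order (th : {ffun 'I_k -> rat}) m n : ordered c B (psum k0 th) ->
  (m <= 5 * k)%N -> (n <= 5 * k)%N ->
  (psum k0 th (diag (bK m)) < psum k0 th (diag (bK n))) = (P (m %% k) < P (n %% k))%N.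
Proof. by move=> o hm hn; rewrite !walk_psum // (orderedE k0 k1 o) ?ltn_pmod. Qed.

Section Window.
Variable v : nat.
Hypotheses (vP : v = P (v %% k)) (v_small : (v < k.*2.-1)%N).

Lemma window_path : is_path (segment bK v k) k (fun i => bK (v + i)%N).
Proof. by apply: (segment_path chamber_walk_step); lia. Qed.

(** A label started before [n] was started at least [k] earlier, hence before [v]. So the single
    rule of the walk restricts on each window to the rule of the stable stair starting there. *)
Lemma window_step n : (v < n < v + k)%N -> chamber_step n.-1 = (P (n %% k) < v)%N.
Proof.
move=> vn; have n0 : (0 < n)%N by lia.
rewrite /chamber_step prednK //.
by apply/idP/idP => [/turn_pos_late|]; lia.
Qed.

Lemma window_order (th : {ffun 'I_k -> rat}) i : ordered c B (psum k0 th) -> (i.+1 < k)%N ->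
  (right_of (bK (v + i)) == bK (v + i.+1))
    = (psum k0 th (diag (bK (v + 0)) + i.+1%:Z) < psum k0 th (diag (bK (v + 0))))
  /\ psum k0 th (diag (bK (v + 0)) + i.+1%:Z) != psum k0 th (diag (bK (v + 0))).
Proof.
move=> o ik; split; last first.
  apply/eqP => /(ordered_separated k0 k1 (psum_periodic k0 th) o).
  by rewrite -[X in _ = resid _ X]addr0 => /(resid_inj ik k0); lia.
have -> : diag (bK (v + 0)) + i.+1%:Z = diag (bK (v + i.+1)).
  by rewrite !chamber_walk_diag //; lia.
rewrite walk_order //; try lia.
rewrite addn0 -vP addnS [LHS]walk_rightE; last by lia.
by apply: (window_step (n := (v + i).+1)); lia.
Qed.

Lemma window_rank (th : {ffun 'I_k -> rat}) : ordered c B (psum k0 th) ->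
  rank k (psum k0 th) (diag (bK (v + 0))) = (\sum_(i < k) (P i < v))%N.
Proof.
move=> o; pose f z : nat := (psum k0 th z < psum k0 th (diag (bK (v + 0))))%R.
have fp : periodic k f by move=> z; rewrite /f psum_periodic.
have -> : rank k (psum k0 th) (diag (bK (v + 0))) =
    (\sum_(0 <= i < k) f ((c : nat)%:Z + i%:Z)%R)%N.
  exact: (sum_period k0 (c : nat)%:Z fp).
rewrite big_mkord; apply: eq_bigr => i _.
rewrite /f addn0 walk_psum; last by lia.
by rewrite (orderedE k0 k1 o) ?ltn_pmod // -vP.
Qed.

End Window.

(* One period later the walk makes the same step, as no stair starts strictly
   between [v] and [v']. *)
Lemma window_consecutive v v' : v = P (v %% k) -> (v < k.*2.-1)%N -> (v' < k.*2.-1)%N ->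
  (v < v' < v + k)%N ->
  (forall i, (i < k)%N -> (P i <= v)%N || (v' <= P i)%N) ->
  consecutive k (segment bK v k) (segment bK v' k).
Proof.
move=> vP vb vb' vv' gap.
have vk1 : (v + k.-1 <= 5 * k)%N by lia.
(* A height of at least [k] remains, which makes the subtraction in [b2] below exact. *)
have low n : (n <= 4 * k)%N -> (k <= (bK n).2)%N.
  move=> nk; have h := leq_trans (walk_bound chamber_step n) nk.
  rewrite /bK /walk /= leq_subRL; last by apply: leq_trans h _; rewrite leq_mul2r orbT.
  by rewrite [X in (_ <= X)%N](_ : _ = 4 * k + k)%N ?leq_add2r // -mulSnr.
(* The walk is hidden behind an opaque [b], so that only the facts gathered next are seen by the
   arithmetic. *)
have [b bE] : exists b, b = bK by exists bK.
have pv := window_path vP vb.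
have dg := chamber_walk_diag; have inj := chamber_walk_inj.
have stepR := chamber_walkR; have stepD := chamber_walkD.
rewrite -bE in low pv dg inj stepR stepD *.
pose f := b v; pose l := b (v + k.-1)%N.
have mono i : (i < k)%N -> [/\ f.1 <= (b (v + i)).1, (b (v + i)).1 <= l.1,
    (b (v + i)).2 <= f.2 & l.2 <= (b (v + i)).2]%N.
  move=> ik; have kk : (k.-1 < k)%N by lia. have ik1 : (i <= k.-1)%N by lia.
  have := path_mono pv (leq0n i) ik; have := path_mono pv ik1 kk.
  by rewrite addn0 -/f -/l => /andP[-> ->] /andP[-> ->].
have [m1 _ _ m2] := mono 0%N k0; rewrite addn0 -/f in m1 m2.
have kk : (k.-1 < k)%N by lia.
have [l1 _ l2 _] := mono k.-1 kk; rewrite -/l in l1 l2.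
(* The diagonal grows by [k - 1] from the first to the last box of the window; hence the translation
   taking [f] to the box right of [l] moves diagonals by [k] and preserves labels. *)
have fl : (l.1 + f.2 + 1 = f.1 + l.2 + k)%N.
  have := dg _ vk1; rewrite -/l; have := dg v; rewrite -/f /diag.
  lia.
have lk : (k <= l.2)%N by apply: low; lia.
pose b2 i : box := ((b (v + i)).1 + (l.1 + 1 - f.1), (b (v + i)).2 - (f.2 - l.2))%N.
pose S2 := segment b2 0 k.
have b20 : b2 0%N = right_of l.
  by rewrite /b2 addn0 -/f /right_of; congr (_, _); lia.
exists S2; split.
(* The vertical part of the translation points downwards, so it is applied to the other side. *)
- exists (l.1 + 1 - f.1, 0)%N, (0, f.2 - l.2)%N; split; last first.
    by rewrite /= add0n (_ : l.1 + 1 - f.1 + (f.2 - l.2) = k)%N ?modnn ?mod0n //; lia.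
  apply/fsetP => p; apply/imfsetP/imfsetP => /= -[q /segmentP[i ik ->] ->].
    exists (b2 (i - v)%N); first by apply/segmentP; exists (i - v)%N => //; lia.
    have ik' : (i - v < k)%N by lia.
    have [_ _ _ h] := mono _ ik'; rewrite /b2 /= subnKC in h *; last by lia.
    have [_ _ h' _] := mono _ ik'; rewrite subnKC in h'; last by lia.
    by congr (_, _); lia.
  have ik' : (i < k)%N by lia.
  exists (b (v + i)%N); first by apply/segmentP; exists (v + i)%N => //; lia.
  have [_ _ h h'] := mono _ ik'; by rewrite /b2 /=; congr (_, _); lia.
- exists l; split; split.
  + by apply/segmentP; exists (v + k.-1)%N => //; lia.
  + move=> q /segmentP[i ik ->]; have ik' : (i - v < k)%N by lia.
    by have [_ h1 _ h2] := mono _ ik'; rewrite subnKC in h1 h2; rewrite /before ?h1 ?h2 //; lia.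
  + by rewrite -b20; apply/segmentP; exists 0%N => //; lia.
  + move=> q /segmentP[i ik ->]; have ik' : (i < k)%N by lia.
    have [h1 _ h2 _] := mono _ ik'.
    by rewrite /before /right_of /b2 /=; lia.
- have glue i : (v + i < v')%N -> b (v + k + i)%N = b2 i.
    elim: i => [|i IH] iv.
      (* The gluing edge: position [v + k] repeats the label that started at [v], hence is entered
         rightwards. *)
      rewrite b20 addn0 -[in LHS](prednK k0) addnS stepR //; first by lia.
      rewrite /chamber_step -addnS prednK // modnDr -vP; lia.
    have {}IH : b (v + k + i)%N = b2 i by apply: IH; lia.
    have ik : (i.+1 < k)%N by lia.
    have same : chamber_step (v + k + i) = chamber_step (v + i).
      rewrite /chamber_step (_ : (v + k + i).+1 = (v + i).+1 + k)%N; last by lia.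
      rewrite modnDr; have := gap _ (ltn_pmod (v + i).+1 k0); case/orP => h.
        by apply/idP/idP; lia.
      by have := @turn_pos_early (v + i).+1; move=> e; apply/idP/idP; lia.
    have [_ _ h3 h4] := mono _ ik; rewrite !addnS in h3 h4 *.
    have [w|w] := boolP (chamber_step (v + i)).
      rewrite (stepR (v + k + i)%N) ?same //; last by lia.
      rewrite IH /b2 (addnS v) (stepR (v + i)%N) //; lia.
    have e1 := @stepD (v + k + i)%N; rewrite same IH in e1.
    have e2 := @stepD (v + i)%N.
    have lt1 : (v + k + i < 5 * k)%N by lia. have lt2 : (v + i < 5 * k)%N by lia.
    move: (e1 lt1 w) (e2 lt2 w); rewrite /b2 (addnS v).
    case: (b (v + k + i).+1) => x y; rewrite /above => -[/= ex ey] e; rewrite e /= in ex ey.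
    by congr (_, _); lia.
  apply/fsubsetP => p /segmentP[i iv ->]; rewrite inE.
  have [h|h] := ltnP i (v + k); apply/orP; [left | right].
    by apply/segmentP; exists i => //; lia.
  apply/segmentP; exists (i - v - k)%N; first by lia.
  by rewrite -glue; [congr b | ]; lia.
- apply/fset0Pn; exists (b v'); rewrite inE; apply/andP; split.
    by apply/segmentP; exists v' => //; lia.
  by apply/segmentP; exists v' => //; lia.
- split; first by exact: fsubsetIl.
  move=> p q; rewrite !inE => /andP[/segmentP[i iv ->] /segmentP[j jv e]] /segmentP[n nv ->] bf.
  apply/andP; split; apply/segmentP; exists n => //.
  have ij : i = j by apply: inj; rewrite ?e //; lia.
  have : diag (b i) <= diag (b n) by move: bf; rewrite /before /diag; lia.
  by rewrite !dg; lia.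
Qed.

(** Positions below [k] are entered downwards, so a box before position [k - 1] has a box below it.
    Positions from [2k - 1] on are entered rightwards, so a box there has one to its left. All
    generators thus lie in the window starting at [k - 1], and the boxes adjacent to that window are
    above its first box and to the right of its last one, which spoils no generator. *)
Lemma window_generators (v : nat -> nat) j0 : v 1%N = 0%N ->
  (forall j, (0 < j < k)%N -> (v j < v j.+1 < v j + k)%N) ->
  (forall j, (0 < j <= k)%N -> (v j < k.*2.-1)%N) ->
  (0 < j0 <= k)%N -> v j0 = k.-1 ->
  generators (segment bK (v j0) k) =
  generators (\bigcup_(j <- iota 1 k) segment bK (v j) k)%fset.
Proof.
move=> v1 vgap vb j0k vj0.
pose S j := segment bK (v j) k; rewrite -/(S j0).
set SK := (\bigcup_(j <- iota 1 k) segment bK (v j) k)%fset.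
have kk1 : (k.-1 < k)%N by lia.
have vlt i j : (0 < i)%N -> (i < j <= k)%N -> (v i < v j)%N.
  by apply: (@increasing_between _ nat) => l /vgap/andP[].
have vle i j : (0 < i)%N -> (i <= j <= k)%N -> (v i <= v j)%N.
  by move=> i0 ij; have [->//|ne] := eqVneq i j; apply/ltnW/vlt => //; lia.
have SKP p : p \in SK -> exists2 n, (n < v k + k)%N & p = bK n.
  case/bigfcupP => j; rewrite mem_iota andbT => jk /segmentP[n nv ->].
  by exists n => //; have := vle j k; lia.
have sub j : (0 < j <= k)%N -> (S j `<=` SK)%fset.
  move=> jk; apply/fsubsetP => p pS; apply/bigfcupP; exists j => //.
  by rewrite mem_iota andbT; lia.
have k1' : (0 < 1 <= k)%N by lia.
have kk : (0 < k <= k)%N by lia.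
have vk := vb k kk.
have early n : (n < k)%N -> (n <= P (n %% k))%N.
  by move=> nk; rewrite modn_small // leq_addr.
have late n : (k.*2.-1 <= n)%N -> (P (n %% k) < n)%N.
  by move=> nk; apply: leq_trans (turn_pos_bound k0 k1 B (ltn_pmod n k0)) nk.
apply/fsetP => p; apply/generatorsP/generatorsP => -[pS pg].
  split; first exact: (fsubsetP (sub _ j0k)).
  case/segmentP: pS => n; rewrite vj0 => nk pE q /SKP[m mk qE].
  have mk5 : (m <= 5 * k)%N by lia. have nk5 : (n <= 5 * k)%N by lia.
  have inS i : (k.-1 <= i < k.-1 + k)%N -> bK i \in S j0.
    by move=> ik; apply/segmentP; exists i => //; rewrite vj0.
  split=> e; have := congr1 diag e;
    rewrite pE qE ?diag_right ?diag_above !chamber_walk_diag // => d.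
    have nm : n = m.+1 by lia.
    have [nk1|nk1] := eqVneq n k.-1; last first.
      by have [|h _] := pg (bK m); [apply: inS; lia | apply: h; rewrite -qE].
    have : ~~ chamber_step m by rewrite /chamber_step -nm -leqNgt early //; lia.
    move/(chamber_walkD (n := m)); rewrite -nm -pE -qE => h.
    have : q = above p by apply: h; lia.
    by rewrite e; case: (q) => x y [] /eqP; lia.
  have nm : m = n.+1 by lia.
  have [nk1|nk1] := eqVneq m (k.*2.-1); last first.
    by have [|_ h] := pg (bK m); [apply: inS; lia | apply: h; rewrite -qE].
  have : chamber_step n by rewrite /chamber_step -nm late //; lia.
  move/(chamber_walkR (n := n)); rewrite -nm -pE -qE => h.
  have : q = right_of p by apply: h; lia.
  by rewrite e; case: (q) => x y [] /eqP; lia.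
split; last by move=> q qS; apply: pg; apply: (fsubsetP (sub _ j0k)).
case/SKP: pS => n nk pE; apply/segmentP; exists n => //; rewrite vj0.
apply/andP; split.
  rewrite leqNgt; apply/negP => nk1.
  have n1S : bK n.+1 \in SK.
    by apply: (fsubsetP (sub 1%N k1')); apply/segmentP; exists n.+1 => //; rewrite v1; lia.
  have : ~~ chamber_step n by rewrite /chamber_step -leqNgt early //; lia.
  move/(chamber_walkD (n := n)) => h.
  by have [_ h'] := pg _ n1S; apply: h'; rewrite pE h //; lia.
rewrite ltnNge; apply/negP => nk1.
have n1S : bK n.-1 \in SK.
  by apply: (fsubsetP (sub k kk)); apply/segmentP; exists n.-1 => //; lia.
have nS : n = n.-1.+1 by lia.
have : chamber_step n.-1 by rewrite /chamber_step -nS late //; lia.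
move/(chamber_walkR (n := n.-1)); rewrite -nS => h.
by have [h' _] := pg _ n1S; apply: h'; rewrite pE h //; lia.
Qed.

End ChamberWalk.

(** * Equivariant modules and stability *)

Section Characters.
Variables (C : fieldType) (gT : finGroupType) (rG : mx_representation C [set: gT] 2).
Variables (g0 : gT) (xi : C).
Local Notation k := #|gT|.
Hypothesis xi_prim : k.-primitive_root xi.
Hypothesis g0_gen : <[g0]>%g = [set: gT]%SET.
Hypothesis g0_diag : rG g0 = diag_mx (\row_(i < 2) (if i == 0 then xi^-1 else xi)).

Let k0 : (0 < k)%N. Proof. exact: (prim_order_gt0 xi_prim). Qed.

(** This is the character rho_1; the others are its integer powers. *)
Definition chi (g : gT) : C := rG g 1 1.

Lemma xi_neq0 : xi != 0.
Proof.
apply/eqP => x0; have := prim_expr_order xi_prim.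
by rewrite x0 expr0n gtn_eqF // => /esym/eqP; rewrite oner_eq0.
Qed.

Lemma gen_power g : exists n, g = (g0 ^+ n)%g.
Proof. by apply/cycleP; rewrite g0_gen inE. Qed.

Lemma rG_power n :
  rG (g0 ^+ n)%g = diag_mx (\row_(i < 2) (if i == 0 then xi ^- n else xi ^+ n)).
Proof.
elim: n => [|n IH].
  rewrite expg0 repr_mx1 -diag_const_mx; congr diag_mx; apply/rowP => i.
  by rewrite !mxE expr0 invr1 if_same.
rewrite expgS repr_mxM ?inE // IH g0_diag mulmx_diag; congr diag_mx; apply/rowP => i.
by rewrite !mxE; case: (i == 0); rewrite ?exprS ?invfM.
Qed.

Lemma chi_power n : chi (g0 ^+ n)%g = xi ^+ n.
Proof. by rewrite /chi rG_power !mxE /= mulr1n. Qed.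

Lemma chi_gen : chi g0 = xi.
Proof. by rewrite -[g0]expg1 chi_power. Qed.

Lemma chiM g h : chi (g * h)%g = chi g * chi h.
Proof.
have [n ->] := gen_power g; have [m ->] := gen_power h.
by rewrite -expgD !chi_power exprD.
Qed.

Lemma chi1 : chi 1%g = 1.
Proof. by rewrite -(expg0 g0) chi_power. Qed.

Lemma chi_neq0 g : chi g != 0.
Proof. by have [n ->] := gen_power g; rewrite chi_power expf_neq0 // xi_neq0. Qed.

Lemma chiV g : chi g^-1%g = (chi g)^-1.
Proof.
by apply: (mulfI (chi_neq0 g)); rewrite -chiM mulgV chi1 divff // chi_neq0.
Qed.

Lemma chi_order g : chi g ^+ k = 1.
Proof.
by have [n ->] := gen_power g; rewrite chi_power exprAC (prim_expr_order xi_prim) expr1n.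
Qed.

Lemma rG00 g : rG g 0 0 = (chi g)^-1.
Proof. by have [n ->] := gen_power g; rewrite chi_power rG_power !mxE /= mulr1n. Qed.

Lemma rG01 g : rG g 0 1 = 0.
Proof. by have [n ->] := gen_power g; rewrite rG_power !mxE /= mulr0n. Qed.

Lemma rG10 g : rG g 1 0 = 0.
Proof. by have [n ->] := gen_power g; rewrite rG_power !mxE /= mulr0n. Qed.

Lemma chi_inj g : chi g = 1 -> g = 1%g.
Proof.
have [n ->] := gen_power g; rewrite chi_power => /eqP.
rewrite -(prim_order_dvd xi_prim) => /dvdnP[m ->].
by rewrite mulnC expgM -cardsT -g0_gen -orderE expg_order expg1n.
Qed.

Lemma xi_resid a b : xi ^ a = xi ^ b <-> resid k0 a = resid k0 b.
Proof.
have per q : xi ^ (q * k%:Z) = 1.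
  by rewrite mulrC -exprz_exp -[xi ^ k%:Z]/(xi ^+ k) (prim_expr_order xi_prim) exp1rz.
split=> [e|/resid_eq[q ->]]; last by rewrite expfzDr ?xi_neq0 // per mulr1.
have toN z : xi ^ z = xi ^+ resid k0 z.
  rewrite {1}(divz_eq z k) expfzDr ?xi_neq0 // per mul1r /=.
  by rewrite -[RHS]/(xi ^ (`|(z %% k)%Z|%:Z)) gez0_abs // modz_ge0; lia.
move: e; rewrite !toN => /eqP; rewrite (eq_prim_root_expr xi_prim) => /eqP.
by rewrite !modn_small ?resid_subproof // => e; apply: val_inj.
Qed.

Lemma chi_per a b g : resid k0 a = resid k0 b -> chi g ^ a = chi g ^ b.
Proof.
have [n ->] := gen_power g; rewrite chi_power => /xi_resid e.
by rewrite exprnP [LHS]exprzAC e exprzAC.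
Qed.


Lemma k_neq0 : k%:R != 0 :> C.
Proof. exact: prim_root_natf_neq0 xi_prim. Qed.

Lemma sum_chi z : \sum_g chi g ^ z = if resid k0 z == resid k0 0 then k%:R else 0.
Proof.
case: eqP => [e|ne].
  under eq_bigr do rewrite (chi_per _ e) expr0z.
  by rewrite sumr_const cardT -cardE.
have h : (xi ^ z - 1) * (\sum_g chi g ^ z) = 0.
  rewrite mulrBl mul1r; apply/eqP; rewrite subr_eq0; apply/eqP.
  rewrite mulr_sumr [RHS](reindex_inj (mulgI g0)) /=; apply: eq_bigr => g _.
  by rewrite chiM chi_gen exprzMl ?unitfE ?chi_neq0 ?xi_neq0.
move/eqP: h; rewrite mulf_eq0 => /orP[|/eqP //].
by rewrite subr_eq0 -(expr0z xi) => /eqP /xi_resid.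
Qed.

Lemma sum_powers g : \sum_(0 <= i < k) chi g ^+ i = if g == 1%g then k%:R else 0.
Proof.
case: eqP => [->|ne].
  under eq_bigr do rewrite chi1 expr1n.
  by rewrite big_mkord sumr_const cardT -cardE card_ord.
have := subrX1 (chi g) k; rewrite chi_order subrr => /esym/eqP.
rewrite mulf_eq0 subr_eq0 => /orP[/eqP/chi_inj //|/eqP].
by rewrite big_mkord.
Qed.

(** * Isotypic parts of an equivariant module *)

Section Equivariant.
Variable M : gmodule C gT.
Hypothesis eqM : equivariant rG M.

Definition isotypic (z : int) (v : M) : Prop := forall g, grp_act M g v = chi g ^ z *: v.

Lemma act1 v : grp_act M 1%g v = v.
Proof. by case: eqM => -> _ _ _ _; rewrite lfunE. Qed.

Lemma actM g h v : grp_act M (g * h)%g v = grp_act M g (grp_act M h v).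
Proof. by case: eqM => _ -> _ _ _; rewrite comp_lfunE. Qed.

Lemma mulx_act g v : grp_act M g (mulx M v) = chi g *: mulx M (grp_act M g v).
Proof.
case: eqM => _ _ _ /(_ g) e _; move/lfunP: e => /(_ v).
by rewrite !comp_lfunE rG00 rG01 add_lfunE !scale_lfunE scale0r addr0 chiV invrK.
Qed.

Lemma muly_act g v : grp_act M g (muly M v) = (chi g)^-1 *: muly M (grp_act M g v).
Proof.
case: eqM => _ _ _ _ /(_ g) e; move/lfunP: e => /(_ v).
by rewrite !comp_lfunE rG10 -/(chi _) add_lfunE !scale_lfunE scale0r add0r chiV.
Qed.

Lemma isotypic_mulx z v : isotypic z v -> isotypic (z + 1) (mulx M v).
Proof.
move=> h g; rewrite mulx_act h linearZ scalerA expfzDr ?chi_neq0 //.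
by rewrite expr1z mulrC.
Qed.

Lemma isotypic_muly z v : isotypic z v -> isotypic (z - 1) (muly M v).
Proof.
move=> h g; rewrite muly_act h linearZ scalerA expfzDr ?chi_neq0 //.
by rewrite exprN1 mulrC.
Qed.

Lemma isotypic_gen z v : grp_act M g0 v = xi ^ z *: v -> isotypic z v.
Proof.
move=> h g; have [n ->] := gen_power g; elim: n => [|n IH].
  by rewrite expg0 act1 chi1 exp1rz scale1r.
rewrite expgS actM IH linearZ /= h scalerA chiM chi_gen exprzMl ?unitfE ?chi_neq0 ?xi_neq0 //.
by rewrite mulrC.
Qed.

Lemma isotypic_per a b v : resid k0 a = resid k0 b -> isotypic a v -> isotypic b v.
Proof. by move=> e h g; rewrite h (chi_per _ e). Qed.

Lemma isotypicP z v :
  isotypic z v <-> v \in passmx.leigenspace (grp_act M g0) (xi ^ z).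
Proof.
rewrite /passmx.leigenspace memv_ker add_lfunE opp_lfunE scale_lfunE id_lfunE subr_eq0.
split=> [h|/eqP]; last exact: isotypic_gen.
by rewrite h chi_gen.
Qed.

Definition proj (z : int) (v : M) : M := (k%:R)^-1 *: \sum_g chi g ^ (- z) *: grp_act M g v.

Lemma proj_isotypic z v : isotypic z (proj z v).
Proof.
move=> h; rewrite /proj linearZ /= linear_sum /= scalerA mulrC -scalerA; congr (_ *: _).
rewrite scaler_sumr [RHS](reindex_inj (mulgI h)) /=; apply: eq_bigr => g _.
rewrite linearZ /= -actM scalerA; congr (_ *: _).
rewrite chiM exprzMl ?unitfE ?chi_neq0 // mulrA -expfzDr ?chi_neq0 // subrr expr0z mul1r //.
Qed.

Lemma proj_on z w v : isotypic w v ->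
  proj z v = if resid k0 w == resid k0 z then v else 0.
Proof.
move=> h; rewrite /proj.
under eq_bigr do rewrite h scalerA -expfzDr ?chi_neq0 //.
rewrite -scaler_suml scalerA sum_chi.
have -> : (resid k0 (- z + w) == resid k0 0) = (resid k0 w == resid k0 z).
  by apply/eqP/eqP => /resid_eq[q e]; apply/resid_eq; exists q; lia.
by case: eqP => _; rewrite ?mulr0 ?scale0r // mulVf ?scale1r // k_neq0.
Qed.

Lemma sum_proj d v : \sum_(0 <= i < k) proj (d + i%:Z) v = v.
Proof.
rewrite -scaler_sumr exchange_big /=.
rewrite (bigD1 1%g) //= [X in _ + X]big1 ?addr0 => [|g ne].
  under eq_bigr do rewrite chi1 exp1rz scale1r act1.
  rewrite big_mkord sumr_const card_ord -scaler_nat scalerA mulVf ?scale1r //.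
  exact: k_neq0.
rewrite -scaler_suml.
have -> : \sum_(0 <= i < k) chi g ^ (- (d + i%:Z)) =
    chi g ^ (- d) * \sum_(0 <= i < k) chi g^-1%g ^+ i.
  rewrite mulr_sumr; apply: eq_bigr => i _.
  by rewrite opprD expfzDr ?chi_neq0 // chiV exprnP exprz_inv.
by rewrite sum_powers -eq_invg1 invgK (negbTE ne) mulr0 scale0r.
Qed.

Lemma proj_sub (E : {vspace M}) z v : (forall g, grp_act M g @: E <= E)%VS ->
  v \in E -> proj z v \in E.
Proof.
move=> sub vE; apply: memvZ; apply: memv_suml => g _; apply: memvZ.
by apply: (subvP (sub g)); apply: memv_img.
Qed.

(** * Modules whose isotypic parts are lines *)

Variable e : int -> M.
Hypothesis e_neq0 : forall z, e z != 0.
Hypothesis e_line : forall z v, isotypic z v <-> v \in <[e z]>%VS.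

Lemma e_isotypic z : isotypic z (e z).
Proof. by apply/e_line; rewrite memv_line. Qed.

Lemma leigenspace_line z : passmx.leigenspace (grp_act M g0) (xi ^ z) = <[e z]>%VS.
Proof.
by apply/vspaceP => v; apply/idP/idP => [/isotypicP/e_line|/e_line/isotypicP].
Qed.

(** The vectors [e z] are chosen independently and need not be periodic; only their lines are. *)
Lemma line_per a b : resid k0 a = resid k0 b -> <[e a]>%VS = <[e b]>%VS.
Proof.
by move=> h; apply/vspaceP => v; apply/idP/idP => /e_line H; apply/e_line;
  [apply: isotypic_per H | apply: isotypic_per (esym h) H].
Qed.

Lemma mem_line_per (E : {vspace M}) a b : resid k0 a = resid k0 b ->
  (e a \in E) = (e b \in E).
Proof. by move=> h; rewrite !memvE (line_per h). Qed.

Lemma mem_isotypic (E : {vspace M}) z v : isotypic z v -> v \in E -> v != 0 -> e z \in E.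
Proof.
move=> /e_line/vlineP[a ->]; rewrite scaler_eq0 negb_or => + /andP[a0 _].
by rewrite rpredZeq (negbTE a0).
Qed.

Definition act_stable (E : {vspace M}) := forall g, (grp_act M g @: E <= E)%VS.

(** A G-stable subspace contains the projections of its vectors, so it is the sum of the lines that
    it contains. *)
Lemma vspace_lines (E F : {vspace M}) d : act_stable E ->
  (forall i, (i < k)%N -> e (d + i%:Z) \in E -> e (d + i%:Z) \in F) -> (E <= F)%VS.
Proof.
move=> sE h; apply/subvP => v vE; rewrite -(sum_proj d v) big_mkord.
apply: memv_suml => i _; have [->|ne] := eqVneq (proj (d + (i : nat)%:Z) v) 0; first exact: mem0v.
have /e_line/vlineP[a ->] := proj_isotypic (d + (i : nat)%:Z) v.
apply/memvZ/h => //; apply: mem_isotypic ne; first exact: proj_isotypic.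
exact: proj_sub.
Qed.

Lemma theta_valE (th : stability gT) (E : {vspace M}) :
  theta_val g0 xi th E = \sum_(i < k) th i *+ (e (i : nat)%:Z \in E).
Proof.
apply: eq_bigr => i _; congr (_ *+ _).
rewrite -[xi ^+ i]/(xi ^ (i : nat)%:Z) leigenspace_line.
case: (boolP (_ \in E)) => h; first by rewrite (capv_idPr _) -?memvE // dim_vline e_neq0.
suff -> : (E :&: <[e (i : nat)%:Z]>)%VS = 0%VS by rewrite dimv0.
apply/eqP; rewrite -subv0; apply/subvP => v; rewrite memv_cap => /andP[vE /e_line vi].
by rewrite memv0; apply: contraNT h => v0; apply: mem_isotypic v0.
Qed.

Lemma theta_val_psum (th : stability gT) (E : {vspace M}) d : \sum_i th i = 0 ->
  theta_val g0 xi th E =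
  \sum_(0 <= i < k) (psum k0 th (d + i%:Z + 1) - psum k0 th (d + i%:Z)) *+ (e (d + i%:Z) \in E).
Proof.
move=> th0; rewrite theta_valE.
pose f z : rat := th (resid k0 z) *+ (e z \in E).
have fp : periodic k f.
  move=> z; have h : resid k0 (z + k%:Z) = resid k0 z by apply/resid_eq; exists 1; lia.
  by rewrite /f h (mem_line_per _ h).
transitivity (\sum_(i < k) f (i : nat)%:Z).
  by apply: eq_bigr => i _; rewrite /f resid_nat.
rewrite (sum_period k0 d fp); apply: eq_bigr => i _.
by rewrite psumS // [_ + th _]addrC addrK.
Qed.

Definition span_lines (I : pred int) : {vspace M} :=
  (\sum_(i < k | I (i : nat)%:Z) <[e (i : nat)%:Z]>)%VS.

Lemma mem_span_lines (I : pred int) z : periodic k I -> (e z \in span_lines I) = I z.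
Proof.
move=> Ip; apply/idP/idP => [|Iz].
  case/memv_sumP => v vI ez; apply: contraT => nI.
  have : proj z (e z) = 0.
    rewrite ez /proj; under eq_bigr do rewrite linear_sum scaler_sumr.
    rewrite exchange_big scaler_sumr big1 // => i Ii.
    have /e_line h := vI i Ii; rewrite -[LHS]/(proj z (v i)) (proj_on _ h).
    by case: eqP => // /(periodic_resid Ip) E; rewrite E (negbTE nI) in Ii.
  rewrite (proj_on _ (e_isotypic z)) eqxx => /eqP; rewrite (negbTE (e_neq0 z)) //.
have h := resid_nat k0 (resid k0 z).
rewrite -(mem_line_per _ h) memvE.
by apply: (sumv_sup (resid k0 z)) => //; rewrite (periodic_resid Ip h).
Qed.

Lemma span_lines_subsheaf (I : pred int) : periodic k I ->
  (forall z, I z -> ~~ I (z + 1) -> mulx M (e z) = 0) ->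
  (forall z, I z -> ~~ I (z - 1) -> muly M (e z) = 0) ->
  subsheaf (span_lines I).
Proof.
move=> Ip hx hy.
have main (f : 'End(M)) : (forall z, I z -> f (e z) \in span_lines I) ->
    (f @: span_lines I <= span_lines I)%VS.
  move=> h; apply/subvP => _ /memv_imgP[v /memv_sumP[w wI ->] ->].
  rewrite linear_sum; apply: memv_suml => i Ii; have /vlineP[a ->] := wI i Ii.
  by rewrite linearZ; apply/memvZ/h.
split=> [g||]; apply: main => z Iz.
- by rewrite e_isotypic; apply: memvZ; rewrite mem_span_lines.
- have [I1|/hx -> //] := boolP (I (z + 1)); last exact: mem0v.
  have /e_line/vlineP[a ->] := isotypic_mulx (e_isotypic z).
  by apply: memvZ; rewrite mem_span_lines.
- have [I1|/hy -> //] := boolP (I (z - 1)); last exact: mem0v.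
  have /e_line/vlineP[a ->] := isotypic_muly (e_isotypic z).
  by apply: memvZ; rewrite mem_span_lines.
Qed.

End Equivariant.

(** In the regular representation a function of a given character is determined by its value at 1,
    so each isotypic part is spanned by a power of [chi]. *)
Lemma constellation_lines (M : gmodule C gT) : constellation rG M ->
  exists e : int -> M, (forall z, e z != 0) /\
    (forall z v, isotypic z v <-> v \in <[e z]>%VS).
Proof.
case=> eqM [f [[f' fK f'K] fact]].
pose u z : {ffun gT -> C^o} := [ffun g => chi g ^ (- z)].
have f_eq v w : f v = f w -> v = w by move=> h; rewrite -[v]fK h fK.
have fv z v : isotypic z v <-> f v = f v 1%g *: u z.
  split=> [h|h g].
    apply/ffunP => g; rewrite !ffunE.
    have /ffunP/(_ 1%g) := fact g^-1%g v; rewrite ffunE invgK mulg1 => <-.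
    rewrite h linearZ !ffunE chiV exprz_inv; exact: mulrC.
  have fvx y : f v y = f v 1%g * chi y ^ (- z) by rewrite {1}h !ffunE.
  apply: f_eq; rewrite fact linearZ; apply/ffunP => x; rewrite !ffunE (fvx x) (fvx (g^-1 * x)%g).
  rewrite chiM exprzMl ?unitfE ?chi_neq0 // chiV exprz_inv opprK.
  exact: mulrCA.
exists (fun z => f' (u z)); split=> [z|z v].
  apply/eqP => e0; have /ffunP/(_ 1%g) := f'K (u z).
  rewrite e0 linear0 !ffunE chi1 exp1rz => /esym/eqP; by rewrite oner_eq0.
split=> [/fv h|/vlineP[a ->]].
  apply/vlineP; exists (f v 1%g); apply: f_eq; rewrite linearZ /= f'K; exact: h.
apply/fv; rewrite linearZ /= f'K; congr (_ *: _).
by rewrite !ffunE chi1 exp1rz [RHS]mulr1.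
Qed.

(** Subsheaves of [N] are pulled back to [M]. This replaces an arbitrary stable constellation by its
    stair module, where paths can be used. *)
Lemma isomorphic_stable th (M N : gmodule C gT) :
  isomorphic M N -> stable g0 xi th M -> stable g0 xi th N.
Proof.
case=> f [[f' fK f'K] fg fx fy] st E [sg sx sy] E0 E1.
have lfg h v : f (grp_act M h v) = grp_act N h (f v).
  by have /lfunP/(_ v) := fg h; rewrite !comp_lfunE.
have lfx v : f (mulx M v) = mulx N (f v) by have /lfunP/(_ v) := fx; rewrite !comp_lfunE.
have lfy v : f (muly M v) = muly N (f v) by have /lfunP/(_ v) := fy; rewrite !comp_lfunE.
pose E' := (f @^-1: E)%VS.
have mE' v : (v \in E') = (f v \in E) by rewrite memv_preim.
have sub (a : 'End(M)) (b : 'End(N)) : (forall v, f (a v) = b (f v)) ->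
    (b @: E <= E)%VS -> (a @: E' <= E')%VS.
  move=> ab /subvP bE; apply/subvP => _ /memv_imgP[v vE ->]; rewrite mE' ab.
  by apply/bE/memv_img; rewrite -mE'.
have f0 : lker f == 0%VS.
  by apply/lker0P => v w h; rewrite -[v]fK h fK.
suff -> : theta_val g0 xi th E = theta_val g0 xi th E'.
  apply: st.
  - by split=> [g||]; [apply: sub (sg g) | apply: sub sx | apply: sub sy].
  - move=> h; apply: E0; apply/eqP; rewrite -subv0; apply/subvP => v vE.
    have : f' v \in E' by rewrite mE' f'K.
    by rewrite h !memv0 => /eqP h'; rewrite -[v]f'K h' linear0.
  - move=> h; apply: E1; apply/eqP; rewrite eqEsubv subvf /=; apply/subvP => v _.
    by rewrite -[v]f'K -mE' h memvf.
apply: eq_bigr => i _; congr (_ *+ _).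
rewrite -(limg_dim_eq (f := f)); last first.
  by rewrite (eqP f0) capv0.
congr (\dim _); apply/vspaceP => v; rewrite memv_cap; apply/andP/memv_imgP.
  rewrite /passmx.leigenspace memv_ker add_lfunE opp_lfunE scale_lfunE id_lfunE subr_eq0.
  case=> vE /eqP h; exists (f' v); last by rewrite f'K.
  rewrite memv_cap mE' f'K vE /= memv_ker add_lfunE opp_lfunE scale_lfunE id_lfunE subr_eq0.
  by rewrite -(inj_eq (can_inj fK)) lfg linearZ /= f'K h.
case=> w; rewrite memv_cap mE' => /andP[wE].
rewrite /passmx.leigenspace memv_ker add_lfunE opp_lfunE scale_lfunE id_lfunE subr_eq0 => /eqP h ->.
by rewrite wE memv_ker add_lfunE opp_lfunE scale_lfunE id_lfunE subr_eq0 -lfg h linearZ.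
Qed.

(** In a decomposition each label falls in exactly one summand, so the two theta values add up to
    zero and cannot both be positive. *)
Lemma stable_indecomposable (th : stability gT) (M : gmodule C gT) : \sum_i th i = 0 ->
  constellation rG M -> stable g0 xi th M -> indecomposable M.
Proof.
move=> th0 cM st E1 E2 s1 s2 E12 E0.
have [e [e_neq0 e_line]] := constellation_lines cM; case: (cM) => eqM _.
have [->|n1] := eqVneq E1 fullv; first by left.
have [->|n2] := eqVneq E2 fullv; first by right.
have p1 : 0 < theta_val g0 xi th E1.
  by apply: st => //; [move=> h; move: n2; rewrite -E12 h add0v eqxx | exact/eqP].
have p2 : 0 < theta_val g0 xi th E2.
  by apply: st => //; [move=> h; move: n1; rewrite -E12 h addv0 eqxx | exact/eqP].
suff h : theta_val g0 xi th E1 + theta_val g0 xi th E2 = 0.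
  by have := addr_gt0 p1 p2; rewrite h ltxx.
rewrite !(theta_valE eqM e_neq0 e_line) -big_split -[RHS]th0; apply: eq_bigr => i _.
rewrite /=; set w := e _; rewrite -mulrnDr.
suff -> : ((w \in E1) + (w \in E2))%N = 1%N by rewrite mulr1n.
have iw : isotypic (i : nat)%:Z w by exact: e_isotypic.
have : w \in (E1 + E2)%VS by rewrite E12 memvf.
case/memv_addP => u uE [v vE] wuv.
have pw : w = proj (i : nat)%:Z u + proj (i : nat)%:Z v.
  rewrite -[LHS](_ : proj (i : nat)%:Z w = w); last by rewrite (proj_on _ iw) eqxx.
  rewrite /proj -scalerDr -big_split; congr (_ *: _); apply: eq_bigr => g _.
  by rewrite /= -scalerDr -linearD -wuv.
have uE' : proj (i : nat)%:Z u \in E1 by case: s1 => s1 _ _; exact: proj_sub.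
have vE' : proj (i : nat)%:Z v \in E2 by case: s2 => s2 _ _; exact: proj_sub.
have nboth : ~~ ((w \in E1) && (w \in E2)) by rewrite -memv_cap E0 memv0 e_neq0.
have one : (w \in E1) || (w \in E2).
  have [u0|u0] := eqVneq (proj (i : nat)%:Z u) 0.
    by rewrite pw u0 add0r vE' orbT.
  apply/orP; left; apply: (mem_isotypic e_line _ uE' u0); exact: proj_isotypic.
by move: nboth one; case: (w \in E1); case: (w \in E2).
Qed.

Lemma linfun_ffunE (I : finType) (F : {ffun I -> C^o} -> {ffun I -> C^o}) :
  linear F -> linfun F =1 F.
Proof.
move=> lF; pose L : {linear {ffun I -> C^o} -> {ffun I -> C^o}} :=
  HB.pack F (GRing.isLinear.Build _ _ _ _ F lF).
exact: (lfunE L).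
Qed.

(** * Modules of stairs *)

Section StairModule.
Variable S : {fset box}.
Local Notation M := (stair_module rG S).

Lemma stair_actE g (f : M) (p : S) :
  (grp_act M g f : {ffun S -> C^o}) p = chi g ^ diag (val p) * (f : {ffun S -> C^o}) p.
Proof.
rewrite linfun_ffunE => [|a u v]; last first.
  by apply/ffunP => q; rewrite !ffunE /= scalerDr; congr (_ + _); exact: mulrCA.
rewrite ffunE rG00 -/(chi _) chiV invrK /diag expfzDr ?chi_neq0 //.
by rewrite -exprz_inv.
Qed.

Lemma stair_mulxE (f : M) (p : S) : (mulx M f : {ffun S -> C^o}) p =
  \sum_(q : S | right_of (val q) == val p) (f : {ffun S -> C^o}) q.
Proof.
rewrite linfun_ffunE => [|a u v]; first by rewrite ffunE.
apply/ffunP => q; rewrite !ffunE /= scaler_sumr -big_split /=.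
by apply: eq_bigr => r _; rewrite !ffunE.
Qed.

Lemma stair_mulyE (f : M) (p : S) : (muly M f : {ffun S -> C^o}) p =
  \sum_(q : S | above (val q) == val p) (f : {ffun S -> C^o}) q.
Proof.
rewrite linfun_ffunE => [|a u v]; first by rewrite ffunE.
apply/ffunP => q; rewrite !ffunE /= scaler_sumr -big_split /=.
by apply: eq_bigr => r _; rewrite !ffunE.
Qed.

(** Defined for every box and zero off [S], so that both coordinates act by shifting the box without
    a case distinction. *)
Definition box_vec (p : box) : M := [ffun q : S => (val q == p)%:R] : {ffun S -> C^o}.

Lemma box_vec_out p : p \notin S -> box_vec p = 0.
Proof.
move=> pS; apply/ffunP => q; rewrite !ffunE; case: eqP => // e.
by move: pS; rewrite -e (valP q).
Qed.

Lemma box_vec_neq0 p : p \in S -> box_vec p != 0.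
Proof.
move=> pS; apply/eqP => /ffunP/(_ [` pS]%fset); rewrite !ffunE eqxx => /eqP.
by rewrite oner_eq0.
Qed.

Lemma sum_box_vec (a : pred S) (p : box) (pS : p \in S) :
  \sum_(r : S | a r) (box_vec p : {ffun S -> C^o}) r = (a [` pS]%fset)%:R.
Proof.
have [ap|ap] := boolP (a [` pS]%fset).
  rewrite (bigD1 [` pS]%fset) //= ffunE eqxx big1 ?addr0 // => r /andP[_ ne].
  by rewrite ffunE; case: eqP => // e; case/eqP: ne; apply: val_inj.
rewrite big1 // => r ar; rewrite ffunE; case: eqP => // e; case/negP: ap.
by rewrite -[[` pS]%fset](_ : r = _) //; apply: val_inj.
Qed.

Lemma mulx_box_vec p : p \in S -> mulx M (box_vec p) = box_vec (right_of p).
Proof.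
by move=> pS; apply/ffunP => q; rewrite stair_mulxE (sum_box_vec _ pS) ffunE eq_sym.
Qed.

Lemma muly_box_vec p : p \in S -> muly M (box_vec p) = box_vec (above p).
Proof.
by move=> pS; apply/ffunP => q; rewrite stair_mulyE (sum_box_vec _ pS) ffunE eq_sym.
Qed.

Lemma box_vec_sum (v : M) : v = \sum_(p : S) (v : {ffun S -> C^o}) p *: box_vec (val p).
Proof.
apply/ffunP => q; rewrite sum_ffunE (bigD1 q) //= big1 ?addr0 => [|p ne].
  by rewrite !ffunE eqxx [RHS]mulr1.
rewrite !ffunE; case: eqP => [e|_]; last by rewrite [LHS]mulr0.
by case/eqP: ne; apply: val_inj.
Qed.

Variable b : nat -> box.
Hypothesis Sb : is_path S k b.
Local Notation d := (diag (b 0%N)).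

Lemma stair_equivariant : equivariant rG M.
Proof.
split=> [|g h||g|g].
- apply/lfunP => v; rewrite id_lfunE; apply/ffunP => p.
  by rewrite stair_actE chi1 exp1rz mul1r.
- apply/lfunP => v; rewrite comp_lfunE; apply/ffunP => p.
  by rewrite !stair_actE chiM exprzMl ?unitfE ?chi_neq0 // mulrA.
- apply/lfunP => v; rewrite !comp_lfunE [v]box_vec_sum !linear_sum; apply: eq_bigr => p _.
  rewrite !linearZ /= mulx_box_vec ?(valP p) // muly_box_vec ?(valP p) //; congr (_ *: _).
  (* Both products of the coordinates end at the box [(m+1, n+1)], which a stair never contains; so
     both are zero. *)
  have no (q : box) : q = (((val p).1).+1, ((val p).2).+1) -> box_vec q = 0.
    move=> ->; apply: box_vec_out; case: (path_stair Sb) => [[_ _ nod] _].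
    by apply: nod; case: (p) (valP p) => -[].
  transitivity (0 : M).
    have [h|h] := boolP (above (val p) \in S).
      by rewrite mulx_box_vec // no.
    by rewrite box_vec_out // linear0.
  have [h|h] := boolP (right_of (val p) \in S).
    by rewrite muly_box_vec // no.
  by rewrite box_vec_out // linear0.
- apply/lfunP => v; rewrite !comp_lfunE rG00 rG01 add_lfunE !scale_lfunE scale0r addr0 chiV invrK.
  apply/ffunP => p; rewrite ffunE stair_actE !stair_mulxE [RHS]mulr_sumr mulr_sumr.
  apply: eq_bigr => q /eqP <-; rewrite stair_actE diag_right expfzDr ?chi_neq0 //.
  by rewrite expr1z mulrAC mulrC.
- apply/lfunP => v; rewrite !comp_lfunE rG10 -/(chi _) add_lfunE !scale_lfunE scale0r add0r chiV.
  apply/ffunP => p; rewrite ffunE stair_actE !stair_mulyE [RHS]mulr_sumr mulr_sumr.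
  apply: eq_bigr => q /eqP <-; rewrite stair_actE diag_above expfzDr ?chi_neq0 //.
  by rewrite exprN1 mulrAC mulrC.
Qed.

(** The [k] boxes have consecutive diagonals from [d] on, so each label occurs once, at this
    index. *)
Definition path_line (z : int) : M := box_vec (b (resid k0 (z - d))).

Lemma path_line_neq0 z : path_line z != 0.
Proof. by apply: box_vec_neq0; case: Sb => mem _ _; apply: mem; apply: ltn_ord. Qed.

Lemma path_lineE i : (i < k)%N -> path_line (d + i%:Z) = box_vec (b i).
Proof.
move=> ik; congr (box_vec (b _)).
have -> : d + i%:Z - d = (Ordinal ik : nat)%:Z by rewrite /=; lia.
by rewrite resid_nat.
Qed.

Lemma path_line_isotypic z v : isotypic z v <-> v \in <[path_line z]>%VS.
Proof.
have dz : resid k0 (diag (b (resid k0 (z - d)))) = resid k0 z.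
  rewrite (path_diag Sb) ?ltn_ord //.
  have [q e] := (resid_eq k0 _ _).1 (resid_nat k0 (resid k0 (z - d))).
  by apply/resid_eq; exists q; lia.
split=> [h|/vlineP[a ->] g]; last first.
  rewrite linearZ scalerA mulrC -scalerA; congr (_ *: _); apply/ffunP => p.
  rewrite stair_actE !ffunE; case: eqP => [->|_]; last by rewrite mulr0 [RHS]mulr0.
  by rewrite (chi_per _ dz).
rewrite [v]box_vec_sum; apply: memv_suml => p _.
have [->|vp] := eqVneq ((v : {ffun S -> C^o}) p) 0; first by rewrite scale0r mem0v.
apply: memvZ; suff -> : val p = b (resid k0 (z - d)) by exact: memv_line.
have /ffunP/(_ p) := h g0; rewrite stair_actE ffunE => /(mulIf vp).
rewrite chi_gen => /xi_resid e.
have [i ik [pb _]] := path_diagP Sb (valP p).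
rewrite pb in e *; congr (b _).
apply: (@resid_inj k k0 d) => //.
by rewrite -!(path_diag Sb) ?ltn_ord // e dz.
Qed.

(** The isomorphism is a discrete Fourier transform, sending a box to the character function of its
    label. Its kernel is G-stable, so injectivity is tested on isotypic lines by evaluating at 1;
    surjectivity is a count of dimensions. *)
Lemma stair_constellation : constellation rG M.
Proof.
split; first exact: stair_equivariant.
pose F (v : M) : {ffun gT -> C^o} :=
  [ffun g => \sum_(p : S) chi g ^ (- diag (val p)) * (v : {ffun S -> C^o}) p].
have lF : linear F.
  move=> a u v; apply/ffunP => g; rewrite !ffunE scaler_sumr -big_split /=.
  by apply: eq_bigr => p _; rewrite !ffunE mulrDr; congr (_ + _); exact: mulrCA.
pose L : {linear M -> {ffun gT -> C^o}} := HB.pack F (GRing.isLinear.Build _ _ _ _ F lF).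
have fE v : linfun L v = F v by exact: lfunE.
have act h v : F (grp_act M h v) = [ffun g => F v (h^-1 * g)%g].
  apply/ffunP => g; rewrite !ffunE; apply: eq_bigr => p _.
  rewrite stair_actE mulrA chiM exprzMl ?unitfE ?chi_neq0 // chiV exprz_inv opprK.
  by rewrite [chi g ^ _ * _]mulrC.
exists (linfun L); split; last by move=> h v; rewrite !fE act.
have inj : injective (linfun L).
  suff H v : F v = 0 -> v = 0.
    move=> u v; rewrite !fE => e; apply/eqP; rewrite -subr_eq0; apply/eqP/H.
    by rewrite -[F _]/(L _) linearB /= e subrr.
  move=> v0; rewrite -(sum_proj stair_equivariant 0 v) big1 // => i _.
  have h := proj_isotypic stair_equivariant (0 + i%:Z) v.
  set w := proj _ v in h *.
  have w0 : F w = 0.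
    rewrite -[F w]/(L w) /w /proj linearZ linear_sum big1 => [|g _]; first exact: scaler0.
    rewrite linearZ /= -[F _]/(F _) act; apply/ffunP => x.
    by rewrite [LHS]ffunE [X in _ *: X]ffunE v0 !ffunE; exact: mulr0.
  have [a wa] := vlineP _ _ ((path_line_isotypic _ _).1 h).
  rewrite wa; have /ffunP/(_ 1%g) := w0; rewrite wa ffunE ffunE.
  under eq_bigr do rewrite chi1 exp1rz mul1r ffunE.
  move=> s0; have : \sum_(p : S) a * (path_line (0 + i%:Z) : {ffun S -> C^o}) p = 0 by exact: s0.
  rewrite -mulr_sumr -[path_line _]/(box_vec _).
  have bS : b (resid k0 (0 + i%:Z - d)) \in S.
    by case: Sb => mem _ _; apply/mem/ltn_ord.
  rewrite (sum_box_vec predT bS) mulr1 => ->.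
  by rewrite scale0r.
have f0 : lker (linfun L) == 0%VS by apply/lker0P.
have full : limg (linfun L) = fullv.
  apply/eqP; rewrite eqEdim subvf /= !dimvf limg_dim_eq ?(eqP f0) ?capv0 // dimvf.
  have cS := path_card Sb.
  by rewrite /dim /= !muln1 -cardfE cS.
have [f' f'K] : exists f', cancel f' (linfun L).
  have sur y : exists x, linfun L x == y.
    have : y \in limg (linfun L) by rewrite full memvf.
    by case/memv_imgP => x _ ->; exists x.
  by exists (fun y => xchoose (sur y)) => y; apply/eqP/(xchooseP (sur y)).
exists f' => // x; apply: inj; exact: f'K.
Qed.

Lemma path_right_out i : (i < k)%N -> (i.+1 < k -> right_of (b i) != b i.+1)%N ->
  mulx M (box_vec (b i)) = 0.
Proof.
move=> ik h; case: Sb => mem _ _; rewrite mulx_box_vec ?mem // box_vec_out //.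
by apply/negP => /(path_right Sb ik)[/h ne e]; rewrite e eqxx in ne.
Qed.

Lemma path_above_out i : (i < k)%N -> (0 < i -> above (b i) != b i.-1)%N ->
  muly M (box_vec (b i)) = 0.
Proof.
move=> ik h; case: Sb => mem _ _; rewrite muly_box_vec ?mem // box_vec_out //.
by apply/negP => /(path_above Sb ik)[/h ne e]; rewrite e eqxx in ne.
Qed.

Local Notation R i := (right_of (b i) == b i.+1).

(* Cutting the stair between two boxes leaves a subsheaf on the side that the
   arrow points to. *)
Lemma path_cut (th : stability gT) i : \sum_i th i = 0 -> (i.+1 < k)%N ->
  exists E : {vspace M}, [/\ subsheaf E, E <> 0%VS, E <> fullv &
    theta_val g0 xi th E = if R i then psum k0 th d - psum k0 th (d + i.+1%:Z)
                           else psum k0 th (d + i.+1%:Z) - psum k0 th d].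
Proof.
move=> th0 ik; pose I (z : int) :=
  if R i then (i < resid k0 (z - d))%N else (resid k0 (z - d) <= i)%N.
have Ip : periodic k I.
  move=> z; rewrite /I; suff -> : resid k0 (z + k%:Z - d) = resid k0 (z - d) by [].
  by apply/resid_eq; exists 1; lia.
have Id j : (j < k)%N -> I (d + j%:Z) = if R i then (i < j)%N else (j <= i)%N.
  move=> jk; have e : resid k0 (d + j%:Z - d) = Ordinal jk.
    by rewrite -[RHS](resid_nat k0); congr (resid _ _); rewrite /=; lia.
  by rewrite /I e.
have line := path_line_isotypic; have eqM := stair_equivariant.
have memI j : (j < k)%N -> (path_line (d + j%:Z) \in span_lines path_line I) = I (d + j%:Z).
  by move=> jk; rewrite (mem_span_lines path_line_neq0 line).
exists (span_lines path_line I); split.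
- apply: (span_lines_subsheaf eqM path_line_neq0 line) => // z.
    rewrite /path_line /I (_ : z + 1 - d = z - d + 1); last by lia.
    have := ltn_ord (resid k0 (z - d)); move: (residS k0 (z - d)).
    move: (nat_of_ord (resid k0 (z - d))) (nat_of_ord (resid k0 _)) => m n nE mk h1 h2.
    apply: path_right_out => // mk'; move: nE h1 h2; rewrite ltn_eqF // => ->.
    case: ifP => [e|e] h1 h2; first by lia.
    have -> : m = i by lia.
    by rewrite e.
  rewrite /path_line /I (_ : z - d = z - 1 - d + 1); last by lia.
  have := ltn_ord (resid k0 (z - 1 - d)); move: (residS k0 (z - 1 - d)).
  move: (nat_of_ord (resid k0 (z - 1 - d + 1))) (nat_of_ord (resid k0 (z - 1 - d))).
  move=> n m nE mk h1 h2.
  have nk : (n < k)%N by rewrite nE; case: eqP; lia.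
  apply: path_above_out => // n0; move: nE h1 h2; case: eqP => [_ n0'|_ ->]; first by lia.
  case: ifP => [e|e] h1 h2; last by lia.
  have -> : m = i by lia.
  by rewrite /= -(path_step Sb ik) e.
- move=> E0; have := memI (if R i then i.+1 else i).
  by rewrite E0 memv0 (negbTE (path_line_neq0 _)) Id; case: (R i); rewrite ?ltnSn ?leqnn; lia.
- move=> E0; have := memI (if R i then i else i.+1).
  by rewrite E0 memvf Id; case: (R i); rewrite ?ltnn; lia.
rewrite (theta_val_psum eqM path_line_neq0 line _ d) //.
rewrite (eq_big_nat _ _ (F2 := fun j => (psum k0 th (d + j.+1%:Z) - psum k0 th (d + j%:Z))
   *+ (if R i then i < j else j <= i)%N)); last first.
  move=> j /andP[_ jk]; rewrite memI // Id //; congr ((psum _ _ _ - _) *+ _); lia.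
have ik' : (i.+1 <= k)%N by lia.
rewrite (big_cat_nat (n := i.+1)) //=.
have dk : psum k0 th (d + k%:Z) = psum k0 th d by exact: psum_periodic.
case: (R i).
  rewrite big_nat_cond big1 ?add0r => [|j /andP[/andP[_ ji] _]]; last by rewrite ltnNge -ltnS ji.
  rewrite -[X in X - _]dk -(telescope_sumr (fun j => psum k0 th (d + j%:Z)) ik').
  by apply: eq_big_nat => j /andP[ij _]; rewrite ij.
rewrite [X in _ + X]big_nat_cond [X in _ + X]big1 ?addr0 => [|j /andP[/andP[ij _] _]]; last first.
  by rewrite leqNgt ij.
rewrite -[X in _ - psum k0 th X]addr0.
rewrite -(telescope_sumr (fun j => psum k0 th (d + j%:Z)) (leq0n i.+1)).
by apply: eq_big_nat => j /andP[_ ij]; rewrite -ltnS ij.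
Qed.

(** The cuts of [path_cut] suffice to test stability: summation by parts writes theta of any
    subsheaf as a sum over the places where it is cut, and each term has the sign that the arrow
    there dictates. *)
Lemma path_stability (th : stability gT) : \sum_i th i = 0 ->
  (forall i, (i.+1 < k)%N ->
    if R i then psum k0 th (d + i.+1%:Z) <= psum k0 th d
    else psum k0 th d <= psum k0 th (d + i.+1%:Z)) ->
  semistable g0 xi th M /\
  ((forall i, (i.+1 < k)%N -> psum k0 th (d + i.+1%:Z) != psum k0 th d) -> stable g0 xi th M).
Proof.
move=> th0 hst.
have line := path_line_isotypic; have eqM := stair_equivariant.
pose f i := psum k0 th (d + i%:Z) - psum k0 th d.
have kS : k.-1.+1 = k by rewrite prednK.
have f0 : f 0%N = 0 by rewrite /f addr0 subrr.
have fk : f k.-1.+1 = 0 by rewrite /f kS psum_periodic subrr.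
have main (E : {vspace M}) : subsheaf E ->
    let h i := path_line (d + i%:Z) \in E in
    [/\ theta_val g0 xi th E = \sum_(0 <= i < k.-1.+1) (f i.+1 - f i) *+ h i,
     forall i, (i < k.-1)%N -> f i.+1 < 0 -> h i -> h i.+1 &
     forall i, (i < k.-1)%N -> 0 < f i.+1 -> h i.+1 -> h i].
  case=> _ sx sy h; split.
  - rewrite kS (theta_val_psum eqM path_line_neq0 line _ d) //.
    apply: eq_bigr => i _; rewrite /f opprB addrA addrNK.
    by congr ((psum _ _ _ - _) *+ _); lia.
  - move=> i ik; rewrite subr_lt0 => lt; rewrite /h !path_lineE; try lia.
    have ik' : (i.+1 < k)%N by lia.
    have := hst i ik'; case: ifP => [/eqP <- _|_ le].
    2: by move: (le_lt_trans le lt); rewrite ltxx.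
    have bS : b i \in S by case: Sb => mem _ _; apply: mem; lia.
    by rewrite -mulx_box_vec // => bE; apply/(subvP sx)/memv_img.
  - move=> i ik; rewrite subr_gt0 => lt; rewrite /h !path_lineE; try lia.
    have ik' : (i.+1 < k)%N by lia.
    have := hst i ik'; case: ifP => [_ le|]; first by move: (le_lt_trans le lt); rewrite ltxx.
    have bS : b i.+1 \in S by case: Sb => mem _ _; apply: mem; lia.
    rewrite (path_step Sb ik') => /negbFE/eqP <- _.
    by rewrite -muly_box_vec // => bE; apply/(subvP sy)/memv_img.
split=> [|ne] E sE E0 E1; have [-> hneg hpos] := main E sE.
  by have [] := arrows_sum_ge0 f0 fk hneg hpos.
have [_ pos] := arrows_sum_ge0 f0 fk hneg hpos; apply: pos => [i ik|].
  by rewrite subr_eq0; apply: ne; lia.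
(* A subsheaf cut nowhere contains all the lines or none, hence is full or zero. *)
apply: contrapT => no.
have same i : (i < k)%N -> (path_line (d + i%:Z) \in E) = (path_line (d + 0%:Z) \in E).
  elim: i => // i IH ik; rewrite -IH; last by lia.
  apply/esym/eqP/negP => /negP H; apply: no; exists i => //; lia.
have sta : act_stable E by case: sE.
have [h|h] := boolP (path_line (d + 0%:Z) \in E).
  apply: E1; apply/eqP; rewrite eqEsubv subvf /=.
  apply: (vspace_lines eqM line (d := d)) => [g|i ik _]; first exact: subvf.
  by rewrite same.
apply: E0; apply/eqP; rewrite -subv0; apply: (vspace_lines eqM line (d := d)) => // i ik.
by rewrite same // (negbTE h).
Qed.

Lemma stair_torus_equivariant : torus_equivariant M.
Proof.
pose w (s t : C) (p : box) : C := s ^ (- (p.1)%:Z) * t ^ (- (p.2)%:Z).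
pose T (c : box -> C) : 'End(M) :=
  linfun (fun v : {ffun S -> C^o} => [ffun p : S => c (val p) * v p] : {ffun S -> C^o}).
have TE c (v : M) (p : S) : (T c v : {ffun S -> C^o}) p = c (val p) * (v : {ffun S -> C^o}) p.
  rewrite [T c v]linfun_ffunE ?ffunE // => a u u'.
  by apply/ffunP => q; rewrite !ffunE /= mulrDr; congr (_ + _); exact: mulrCA.
exists (fun s t => T (w s t)); split; [|split; [|split]].
- apply/lfunP => v; apply/ffunP => p; rewrite TE id_lfunE /w !exp1rz !mul1r //.
- move=> s t s' t' s0 t0 s0' t0'; apply/lfunP => v; apply/ffunP => p.
  rewrite comp_lfunE !TE mulrA; congr (_ * _).
  by rewrite /w !exprzMl ?unitfE // mulrACA.
(* One Laurent monomial per box; its coefficient projects onto that box, as distinct boxes have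
   distinct weights. *)
- exists [seq (- (p.1)%:Z, - (p.2)%:Z) | p : box <- S].
  exists (fun q => T (fun p => ((- (p.1)%:Z, - (p.2)%:Z) == q)%:R)) => s t s0 t0.
  apply/lfunP => v; apply/ffunP => p; rewrite sum_lfunE sum_ffunE TE big_map.
  rewrite (bigD1_seq (val p)) ?fset_uniq ?(valP p) //= big1 ?addr0 => [|q ne].
    by rewrite scale_lfunE ffunE TE eqxx mul1r.
  rewrite scale_lfunE ffunE TE; case: eqP => [[/oppr_inj[e1] /oppr_inj[e2]]|_].
    by case/eqP: ne; move: e1 e2; case: (q); case: (val p) => ? ? ? ? /= -> ->.
  by rewrite mul0r; exact: mulr0.
- move=> s t s0 t0; split.
  + apply/lfunP => v; apply/ffunP => p.
    rewrite scale_lfunE !comp_lfunE TE ffunE !stair_mulxE mulr_sumr [RHS]mulr_sumr.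
    apply: eq_bigr => q /eqP <-; rewrite TE mulrA; congr (_ * _).
    by rewrite /w /= -addn1 PoszD opprD expfzDr // exprN1 mulrAC mulrC mulrA.
  + apply/lfunP => v; apply/ffunP => p.
    rewrite scale_lfunE !comp_lfunE TE ffunE !stair_mulyE mulr_sumr [RHS]mulr_sumr.
    apply: eq_bigr => q /eqP <-; rewrite TE mulrA; congr (_ * _).
    by rewrite /w /= -addn1 PoszD opprD expfzDr // exprN1 mulrA mulrC.
  + move=> g; apply/lfunP => v; apply/ffunP => p.
    by rewrite !comp_lfunE TE !stair_actE TE mulrCA.
Qed.

End StairModule.

(** Starting at height [k] leaves room for [k - 1] steps down and does not change the label. *)
Lemma path_exists (a : int) (w : nat -> bool) : exists S b,
  [/\ is_path S k b, resid k0 (diag (b 0%N)) = resid k0 a &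
      forall i, (i.+1 < k)%N -> (right_of (b i) == b i.+1) = w i].
Proof.
have [q] := (resid_eq k0 _ _).1 (resid_nat k0 (resid k0 a)).
move: (nat_of_ord (resid k0 a)) => x e; pose b := walk x k w.
exists (segment b 0 k), b; split.
- have := @segment_path b 0 k k; apply=> // i; exact: walk_step.
- apply/resid_eq; exists (q - 1).
  by rewrite /b /walk !big_geq // /diag /= addn0 subn0 e mulrBl mul1r addrA.
- by move=> i ik; rewrite walk_rightE //; lia.
Qed.

Lemma sum_initial (F : nat -> rat) m n : (m <= n)%N ->
  \sum_(0 <= j < n) (F j.+1 - F j) *+ (j < m)%N = F m - F 0%N.
Proof.
move=> mn; rewrite -(telescope_sumr F (leq0n m)) (big_cat_nat (n := m)) //=.
rewrite [X in _ + X]big_nat_cond [X in _ + X]big1 ?addr0 => [|j /andP[/andP[mj _] _]]; last first.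
  by rewrite ltnNge mj.
by apply: eq_big_nat => j /andP[_ ->].
Qed.

(** From a label outside [I], the first entry into [I] is [t] and the first exit after it is
    [t + m]: a maximal cyclic run. *)
Lemma gap_bounds (I : pred int) : periodic k I -> (exists z, I z) -> (exists z, ~~ I z) ->
  exists t m, [/\ (0 < m < k)%N, ~~ I (t - 1), ~~ I (t + m%:Z) &
    forall j, (j < m)%N -> I (t + j%:Z)].
Proof.
move=> Ip [z Iz] [z1 nI1].
have ex0 : exists n, I (z1 + n%:Z).
  by have [i _ e] := resid_surj k0 z1 z; exists i; rewrite (periodic_resid Ip e).
have [n In minn] := ex_minnP ex0.
have n0 : (0 < n)%N by case: (n) In => //; rewrite addr0 (negbTE nI1).
set t := z1 + n%:Z in In.
have [i ik e] := resid_surj k0 t z1.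
have ex1 : exists m, ~~ I (t + m%:Z) by exists i; rewrite (periodic_resid Ip e).
have [m Im minm] := ex_minnP ex1.
have m0 : (0 < m)%N by case: (m) Im => //; rewrite addr0 In.
have mi : (m <= i)%N by apply: minm; rewrite (periodic_resid Ip e).
exists t, m; split=> //.
- by rewrite m0; lia.
- rewrite (_ : t - 1 = z1 + n.-1%:Z); last by rewrite /t; lia.
  by apply/negP => /minn; lia.
- by move=> j jm; apply: contraT => /minm; lia.
Qed.

(* A subsheaf of slope zero splits off the part [J] supported on a maximal cyclic
   interval of labels; both parts then have slope zero, which puts [th] on a wall. *)
Lemma separated_semistable (th : stability gT) (M : gmodule C gT) :
  \sum_i th i = 0 -> separated k0 (psum k0 th) -> constellation rG M ->
  semistable g0 xi th M -> stable g0 xi th M.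
Proof.
move=> th0 sep cM ss E sE E0 E1.
have [e [e0 line]] := constellation_lines cM; have [eqM _] := cM.
rewrite lt_neqAle ss // andbT; apply/negP => /eqP/esym thE.
pose I z := e z \in E.
have Ip : periodic k I.
  by move=> z; apply: (mem_line_per line); apply/resid_eq; exists 1; lia.
have sta : act_stable E by case: sE.
have [] := @gap_bounds I Ip.
- apply: contrapT => no; apply: E0; apply/eqP; rewrite -subv0.
  apply: (vspace_lines eqM line (d := 0)) => // i _ h; by case: no; exists (0 + i%:Z).
- apply: contrapT => no; apply: E1; apply/eqP; rewrite eqEsubv subvf /=.
  apply: (vspace_lines eqM line (d := 0)) => [g|i _ _]; first exact: subvf.
  by apply: contrapT => /negP h; apply: no; exists (0 + i%:Z).
move=> t [m [/andP[m0 mk] It Im Ij]].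
have Iper a b : resid k0 a = resid k0 b -> I a = I b by exact: periodic_resid.
have tE z : resid k0 (t + (resid k0 (z - t) : nat)%:Z) = resid k0 z.
  have [q h] := (resid_eq k0 _ _).1 (resid_nat k0 (resid k0 (z - t))).
  by apply/resid_eq; exists q; lia.
pose J z := (resid k0 (z - t) < m)%N.
have Jp : periodic k J.
  move=> z; rewrite /J; suff -> : resid k0 (z + k%:Z - t) = resid k0 (z - t) by [].
  by apply/resid_eq; exists 1; lia.
have JI z : J z -> I z by move=> Jz; rewrite -(Iper _ _ (tE z)); apply: Ij.
have Jt j : (j < k)%N -> J (t + j%:Z) = (j < m)%N.
  move=> jk; rewrite /J; have -> : t + j%:Z - t = (Ordinal jk : nat)%:Z by rewrite /=; lia.
  by rewrite resid_nat.
pose K z := I z && ~~ J z.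
have Kp : periodic k K by move=> z; rewrite /K Ip Jp.
(* By maximality the neighbours of the run [J] lie outside [I]. An arrow leaving [J] thus leaves [E]
   and vanishes, and none joins [J] to the rest [K]; so both parts span subsheaves. *)
have Jout z : J z -> ~~ J (z + 1) -> ~~ I (z + 1).
  rewrite /J -(Iper _ _ (tE (z + 1))) (_ : z + 1 - t = z - t + 1); last by lia.
  have := residS k0 (z - t); have := ltn_ord (resid k0 (z - t)).
  set b := nat_of_ord (resid k0 (z - t + 1)); set a := nat_of_ord (resid k0 (z - t)).
  move=> ak bE am bm.
  suff -> : b = m by [].
  by move: bE; case: eqP; lia.
have Jin z : ~~ J z -> J (z + 1) -> ~~ I z.
  rewrite /J (_ : z + 1 - t = z - t + 1); last by lia.
  have := residS k0 (z - t); have := ltn_ord (resid k0 (z - t)); have := tE z.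
  set b := nat_of_ord (resid k0 (z - t + 1)); set a := nat_of_ord (resid k0 (z - t)).
  move=> aE ak bE am bm; rewrite (Iper _ (t - 1)) // -aE; apply/resid_eq; exists 1.
  by move: bE; case: eqP; lia.
have outx z : I z -> ~~ I (z + 1) -> mulx M (e z) = 0.
  move=> Iz nI; apply/eqP; apply: contraNT nI => h.
  apply: (mem_isotypic line _ _ h); first by apply: isotypic_mulx (e_isotypic line z).
  by case: sE => _ /subvP sx _; apply/sx/memv_img.
have outy z : I z -> ~~ I (z - 1) -> muly M (e z) = 0.
  move=> Iz nI; apply/eqP; apply: contraNT nI => h.
  apply: (mem_isotypic line _ _ h); first by apply: isotypic_muly (e_isotypic line z).
  by case: sE => _ _ /subvP sy; apply/sy/memv_img.
have zE (z : int) : z - 1 + 1 = z by lia.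
pose EJ := span_lines e J; pose EK := span_lines e K.
have memJ z : (e z \in EJ) = J z by apply: (mem_span_lines e0 line).
have memK z : (e z \in EK) = K z by apply: (mem_span_lines e0 line).
have sJ : subsheaf EJ.
  apply: (span_lines_subsheaf eqM e0 line) => // z Jz nJ.
    by apply: outx (JI _ Jz) _; apply: Jout.
  by apply: outy (JI _ Jz) _; apply: Jin; rewrite ?zE.
have sK : subsheaf EK.
  apply: (span_lines_subsheaf eqM e0 line) => // z /andP[Iz nJ]; rewrite negb_and negbK.
    case/orP=> [|J1]; first exact: outx.
    by have := Jin _ nJ J1; rewrite Iz.
  case/orP=> [|J1]; first exact: outy.
  by have := Jout _ J1; rewrite zE Iz => /(_ nJ).
have thJ : theta_val g0 xi th EJ = psum k0 th (t + m%:Z) - psum k0 th t.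
  rewrite (theta_val_psum eqM e0 line _ t) //.
  rewrite -[X in _ - psum k0 th X]addr0 -(sum_initial (fun j => psum k0 th (t + j%:Z)) (ltnW mk)).
  apply: eq_big_nat => j /andP[_ jk]; rewrite memJ Jt //.
  by congr ((psum _ _ _ - _) *+ _); lia.
have sum : theta_val g0 xi th EJ + theta_val g0 xi th EK = 0.
  rewrite -thE !(theta_valE eqM e0 line) -big_split; apply: eq_bigr => i _ /=.
  rewrite memJ memK -mulrnDr; congr (_ *+ _).
  rewrite /K; have := JI (i : nat)%:Z; rewrite -/(I _).
  by case: (J _) => [->|_] //=; rewrite ?andbT ?andbF ?addn0.
have J0 : 0 <= theta_val g0 xi th EJ.
  apply: ss => // h.
    by have := memJ t; rewrite h memv0 (negbTE (e0 _)) -[t]addr0 Jt ?m0 //.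
  have := memJ (t + m%:Z); rewrite h memvf Jt // ltnn //.
have K0 : 0 <= theta_val g0 xi th EK.
  (* [EK] is zero when [I] is a single run, and semistability says nothing about the zero
     subsheaf. *)
  have [h|h] := eqVneq EK 0%VS.
    rewrite (theta_valE eqM e0 line) h big1 // => i _.
    by rewrite memv0 (negbTE (e0 _)).
  apply: ss => //; first exact/eqP.
  by move=> hf; have := memK (t + m%:Z); rewrite hf memvf /K (negbTE Im).
have : psum k0 th (t + m%:Z) = psum k0 th (t + 0%:Z).
  by rewrite addr0; move: thJ sum J0 K0; set x := theta_val _ _ _ _;
    set y := theta_val _ _ _ _; lra.
move/sep => /resid_inj h; have := h mk k0; lia.
Qed.

(** * Walls, chambers and the order of the partial sums *)

Local Notation gen := (Theta_gen rG g0 xi).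

(** Given a tie between two labels [x] and [y], take the stair that starts at [x] and goes right
    exactly when entering a label of smaller partial sum. It is semistable, but the cut just before
    [y] has theta value zero, so it is not stable. *)
Lemma Theta_genP (th : stability gT) :
  gen th <-> \sum_i th i = 0 /\ separated k0 (psum k0 th).
Proof.
split=> [[th0 gen_th]|[th0 sep]]; last first.
  split=> // M cM; split; first exact: separated_semistable.
  by move=> st E sE E0 E1; apply/ltW/st.
split=> // x y xy; apply: contrapT => ne.
pose w i := psum k0 th (x + i.+1%:Z) < psum k0 th x.
have [S [b [Sb bx bw]]] := path_exists x w.
have dE z : psum k0 th (diag (b 0%N) + z) = psum k0 th (x + z).
  apply: (periodic_resid (psum_periodic k0 th) (k0 := k0)).
  by have [q e] := (resid_eq k0 _ _).1 bx; apply/resid_eq; exists q; lia.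
have dE0 : psum k0 th (diag (b 0%N)) = psum k0 th x by have := dE 0; rewrite !addr0.
have [i ik|ss _] := path_stability Sb th0.
  rewrite bw // dE dE0 /w.
  by case: ifP => [/ltW //|/negbT]; rewrite -leNgt.
have st := (gen_th _ (stair_constellation Sb)).1 ss.
have [i ik e] := resid_surj k0 x y.
case: i ik e => [|i] ik e; first by apply: ne; rewrite -e addr0.
have [E [sE E0 E1]] := path_cut Sb th0 ik; rewrite bw // dE dE0.
have := st E sE E0 E1; set v := theta_val _ _ _ _ => v0.
have -> : psum k0 th (x + i.+1%:Z) = psum k0 th y.
  exact: (periodic_resid (psum_periodic k0 th) e).
by rewrite xy subrr if_same => v1; rewrite v1 ltxx in v0.
Qed.

Lemma psum_segment (th th' : stability gT) (t : rat) z :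
  psum k0 [ffun i => (1 - t) * th i + t * th' i] z
  = (1 - t) * psum k0 th z + t * psum k0 th' z.
Proof.
by rewrite /psum !mulr_sumr -big_split; apply: eq_bigr => i _; rewrite ffunE.
Qed.

Lemma segment_order (th th' : stability gT) x y : segment_in_gen rG g0 xi th th' ->
  psum k0 th x < psum k0 th y -> psum k0 th' x < psum k0 th' y.
Proof.
move=> seg lt; rewrite ltNge; apply/negP => le.
set p := psum k0 th x in lt; set q := psum k0 th y in lt.
set p' := psum k0 th' x in le; set q' := psum k0 th' y in le.
(* If the order were reversed, the two affine functions would cross at this rational parameter, and
   the segment would meet a wall there. *)
pose t := (q - p) / ((q - p) + (p' - q')).
have den : 0 < (q - p) + (p' - q') by lra.
have t01 : 0 <= t <= 1.
  by rewrite divr_ge0 ?(ltW den) ?subr_ge0 ?(ltW lt) // ler_pdivrMr // mul1r; lra.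
have [_ sep] := (Theta_genP _).1 (seg t t01).
have e : resid k0 x = resid k0 y.
  apply: sep; rewrite !psum_segment -/p -/q -/p' -/q'.
  apply/eqP; rewrite -subr_eq0; apply/eqP.
  rewrite (_ : _ - _ = t * ((q - p) + (p' - q')) - (q - p)); last by ring.
  by rewrite /t divfK ?subrr // gt_eqF.
by move: lt; rewrite /p /q (periodic_resid (psum_periodic k0 th) e) ltxx.
Qed.

Lemma segment_sym (th th' : stability gT) :
  segment_in_gen rG g0 xi th th' -> segment_in_gen rG g0 xi th' th.
Proof.
move=> seg t /andP[t0 t1]; have h : 0 <= 1 - t <= 1 by lra.
have := seg _ h; rewrite (_ : [ffun i => _] = [ffun i => (1 - t) * th' i + t * th i]) //.
by apply/ffunP => i; rewrite !ffunE; ring.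
Qed.

Lemma segment_same_order (th th' : stability gT) : segment_in_gen rG g0 xi th th' ->
  gen th' /\ same_order (psum k0 th) (psum k0 th').
Proof.
move=> seg; split.
  have := seg 1 isT; rewrite (_ : [ffun i => _] = th') //.
  by apply/ffunP => i; rewrite ffunE subrr mul0r mul1r add0r.
move=> x y; apply/idP/idP; first exact: segment_order.
exact: segment_order (segment_sym seg).
Qed.

(** Strict inequalities shared by both ends survive convex combination, so a single segment links
    any two conditions with the same order. *)
Lemma same_order_segment (th th' : stability gT) : gen th -> gen th' ->
  same_order (psum k0 th) (psum k0 th') -> segment_in_gen rG g0 xi th th'.
Proof.
move=> /Theta_genP[th0 sep] /Theta_genP[th0' _] so t /andP[t0 t1]; apply/Theta_genP; split.
  under eq_bigr do rewrite ffunE.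
  by rewrite big_split /= -!mulr_sumr th0 th0' !mulr0 addr0.
move=> x y; rewrite !psum_segment => e; apply: sep.
have lt u v : psum k0 th u < psum k0 th v ->
    (1 - t) * psum k0 th u + t * psum k0 th' u < (1 - t) * psum k0 th v + t * psum k0 th' v.
  move=> h; have h' := h; rewrite so in h'.
  have [t00|t00] := eqVneq t 0; first by rewrite t00; lra.
  apply: ler_ltD; first by rewrite ler_wpM2l ?subr_ge0 // ltW.
  by rewrite ltr_pM2l // lt_def t00.
by have [/lt|/lt|//] := ltgtP (psum k0 th x) (psum k0 th y); rewrite e ltxx.
Qed.

Lemma linked_order (th th' : stability gT) : gen th ->
  Relation_Operators.clos_refl_trans (stability gT) (segment_in_gen rG g0 xi) th th' <->
  gen th' /\ same_order (psum k0 th) (psum k0 th').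
Proof.
move=> gth; split=> [|[gth' so]]; last first.
  by apply: Relation_Operators.rt_step; apply: same_order_segment.
move=> link; elim: link gth => [x y seg _|x gx|x y z _ IH1 _ IH2 gx].
- exact: segment_same_order.
- by split.
- have [gy so1] := IH1 gx; have [gz so2] := IH2 gy.
  by split=> // a c; rewrite so1 so2.
Qed.

(** * Simple chambers and orders with at most two turns *)

Hypothesis k1 : (1 < k)%N.

(** The cut at a step is a proper subsheaf whose theta value changes sign with the direction of the
    step; positivity leaves one direction. *)
Lemma stable_steps (th : stability gT) S b : \sum_i th i = 0 -> is_path S k b ->
  stable g0 xi th (stair_module rG S) -> forall i, (i.+1 < k)%N ->
  (right_of (b i) == b i.+1)
    = (psum k0 th (diag (b 0%N) + i.+1%:Z) < psum k0 th (diag (b 0%N))).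
Proof.
move=> th0 Sb st i ik; have [E [sE E0 E1 thE]] := path_cut Sb th0 ik.
have := st E sE E0 E1; rewrite thE; case: ifP => _; first by rewrite subr_gt0 => ->.
by rewrite subr_gt0 => h; rewrite ltNge ltW.
Qed.

Lemma stable_width (th : stability gT) S b : \sum_i th i = 0 -> is_path S k b ->
  stable g0 xi th (stair_module rG S) -> width S = (rank k (psum k0 th) (diag (b 0%N))).+1.
Proof.
move=> th0 Sb st; rewrite (path_width Sb) //; congr _.+1.
pose f z : nat := (psum k0 th z < psum k0 th (diag (b 0%N)))%R.
have fp : periodic k f by move=> z; rewrite /f psum_periodic.
have -> : rank k (psum k0 th) (diag (b 0%N)) = (\sum_(0 <= i < k) f (diag (b 0%N) + i%:Z)%R)%N.
  exact: (sum_period k0 (diag (b 0%N)) fp).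
rewrite -[in RHS](prednK k0) big_nat_recl //= {1}/f addr0 ltxx add0n.
apply: eq_big_nat => i /andP[_ ik]; rewrite (stable_steps th0 Sb st) //.
by rewrite -(prednK k0) ltnS.
Qed.

Definition order_chamber (c : 'I_k) (B : {ffun 'I_(k - 2) -> bool}) : set (stability gT) :=
  [set th : stability gT | \sum_i th i = 0 /\ ordered c B (psum k0 th)]%classic.

Lemma order_chamber_gen c B th : order_chamber c B th -> gen th.
Proof.
case=> th0 o; apply/Theta_genP; split=> //.
exact: (ordered_separated k0 k1 (psum_periodic k0 th) o).
Qed.

Lemma order_chamberE c B th : order_chamber c B th ->
  [set th' | Relation_Operators.clos_refl_trans (stability gT)
     (segment_in_gen rG g0 xi) th th']%classic = order_chamber c B.
Proof.
move=> oth; have gth := order_chamber_gen oth; case: (oth) => th0 o.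
apply/seteqP; split=> th' /=.
  move/(linked_order _ gth) => [/Theta_genP[th0' _] so].
  by split=> //; apply: same_ordered so o.
move=> oth'; apply/(linked_order _ gth); split; first exact: order_chamber_gen oth'.
case: oth' => _ o'.
exact: (ordered_same k0 k1 (psum_periodic k0 th) (psum_periodic k0 th') o o').
Qed.

(** Everything is read off diagonals: stability fixes the ranks of the starts, the gluing fixes
    their order on the line, and the shared generators bound their spread. *)
Lemma simple_order_chamber K : simple_chamber rG g0 xi K ->
  exists c B, K = order_chamber c B.
Proof.
case=> [[th gth KE]] [M [S0 [SK [_ _ [GS0 _] [F [S [FS con SKE]]] sg]]]].
have [th0 sep] := (Theta_genP _).1 gth.
set s := psum k0 th in sep; have sp : periodic k s by exact: psum_periodic.
have Kth : K th by rewrite KE /=; apply: Relation_Operators.rt_refl.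
have /choice[b bP] : forall j, exists bj, (0 < j <= k)%N ->
    [/\ is_path (S j) k bj, stable g0 xi th (stair_module rG (S j)) & width (S j) = j].
  move=> j; have [jk|jk] := boolP (0 < j <= k)%N; last by exists (fun _ => (0, 0)%N).
  have [_ [_ st] [GS iso] wS] := FS j jk; have [bj pj] := stair_path GS.
  by exists bj => _; split=> //; apply: isomorphic_stable iso (st _ Kth).
pose d j := diag (b j 0%N).
have rk j : (0 < j <= k)%N -> rank k s (d j) = j.-1.
  by move=> jk; have [pj st wj] := bP j jk; rewrite -[in RHS]wj (stable_width th0 pj st).
have steps j i : (0 < j <= k)%N -> (i.+1 < k)%N ->
    (right_of (b j i) == b j i.+1) = (s (d j + i.+1%:Z) < s (d j)).
  by move=> jk ik; have [pj st _] := bP j jk; exact: (stable_steps th0 pj st).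
have near j : (0 < j < k)%N -> d j < d j.+1 < d j + k%:Z /\
    (forall p p', p \in S j -> p' \in S j.+1 -> diag p = diag p' -> p = p').
  move=> jk; have jk1 : (0 < j <= k)%N by lia. have jk2 : (0 < j.+1 <= k)%N by lia.
  have [pj _ _] := bP j jk1; have [pj1 _ _] := bP j.+1 jk2.
  have [/andP[h1 h2] h3] := consecutive_starts k0 pj pj1 (con j jk); split=> //.
  rewrite h2 andbT lt_neqAle h1 andbT; apply/eqP => e.
  by have := rk _ jk2; rewrite -e rk //=; lia.
have dlt i j : (0 < i)%N -> (i < j <= k)%N -> d i < d j.
  by apply: increasing_between => l /near[/andP[]].
(* Stairs that are not consecutive also agree on common diagonals: the starts increase, so a
   diagonal met by [S i] and [S j.+1] is met by [S j], whose box links the two. *)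
have agree i j p q : (0 < i)%N -> (i <= j <= k)%N -> p \in S i -> q \in S j ->
    diag p = diag q -> p = q.
  move=> i0; elim: j q => [|j IH] q ij pS qS e; first by lia.
  have ik : (0 < i <= k)%N by lia.
  have [pi _ _] := bP i ik.
  have [ij'|ne] := eqVneq i j.+1; first by rewrite -ij' in qS; apply: (path_diag_inj pi).
  have jk : (0 < j < k)%N by lia. have jk1 : (0 < j <= k)%N by lia.
  have jk2 : (0 < j.+1 <= k)%N by lia.
  have [/andP[h1 h2] h3] := near j jk.
  have [pj _ _] := bP j jk1; have [pj1 _ _] := bP j.+1 jk2.
  have [u uk [_ du]] := path_diagP pi pS; have [v vk [_ dv]] := path_diagP pj1 qS.
  have dij : d i <= d j by have [->//|ne'] := eqVneq i j; apply/ltW/dlt => //; lia.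
  pose n := `|diag q - d j|%N.
  have nE : n%:Z = diag q - d j by rewrite /n gez0_abs //; rewrite /d in h1 *; lia.
  have nk : (n < k)%N by rewrite /d in dij nE; lia.
  have rS : b j n \in S j by case: pj => mem _ _; apply: mem.
  have dr : diag (b j n) = diag q by rewrite (path_diag pj nk) -/(d j); lia.
  have -> : q = b j n by apply/esym/h3.
  by apply: IH => //; [lia | rewrite dr].
have memSK p : reflect (exists2 j, (0 < j <= k)%N & p \in S j) (p \in SK).
  rewrite SKE; apply: (iffP (bigfcupP _ _ _ _)) => [[j]|[j jk pS]].
    by rewrite mem_iota andbT => jk pS; exists j => //; lia.
  by exists j => //; rewrite mem_iota andbT; lia.
have agree' i j p q : (0 < i <= k)%N -> (0 < j <= k)%N -> p \in S i -> q \in S j ->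
    diag p = diag q -> p = q.
  move=> ik jk pS qS e; have [ij|ji] := leqP i j.
    by apply: (agree i j) => //; lia.
  by apply/esym/(agree j i) => //; lia.
have k1' : (0 < 1 <= k)%N by lia.
have kk' : (0 < k <= k)%N by lia.
have [p1 _ _] := bP 1%N k1'; have [pk _ _] := bP k kk'.
have slt i j : (0 < i <= k)%N -> (0 < j <= k)%N -> (i < j)%N -> s (d i) < s (d j).
  by move=> ik jk ij; rewrite ltNge; apply/negP => /(rank_mono k); rewrite !rk //; lia.
have smin' z : s (d 1%N) <= s z.
  by rewrite leNgt; apply/negP => /(rank_lt_mono k0 sp); rewrite rk.
have smax z : s z <= s (d k).
  rewrite leNgt; apply/negP => /(rank_lt_mono k0 sp); rewrite rk //.
  by have := rank_bound k0 z sp; lia.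
(* [s] is least at [d 1] and largest at [d k], so the first stair is a column and the last one a
   row. *)
have down1 i : (i.+1 < k)%N -> (right_of (b 1%N i) == b 1%N i.+1) = false.
  by move=> ik; rewrite steps // ltNge smin'.
have rightk i : (i.+1 < k)%N -> right_of (b k i) == b k i.+1.
  move=> ik; rewrite steps // lt_neqAle smax andbT; apply/eqP => /sep.
  by rewrite -[d k in RHS]addr0 => /(resid_inj ik k0); lia.
(* The last box of the first stair and the first box of the last one generate the
   chamber stair, hence fit into a single stair of [k] boxes. *)
have gen1 : b 1%N k.-1 \in generators SK.
  have kk1 : (k.-1 < k)%N by lia. have kk2 : (k.-2 < k)%N by lia.
  have bS : b 1%N k.-1 \in S 1%N by case: p1 => mem _ _; apply: mem.
  have d1 := path_diag p1 kk1.
  apply/generatorsP; split; first by apply/memSK; exists 1%N.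
  move=> q /memSK[j jk qS]; split=> e.
    have bS' : b 1%N k.-2 \in S 1%N by case: p1 => mem _ _; apply: mem.
    have dq := congr1 diag e; rewrite diag_right in dq.
    have qE : b 1%N k.-2 = q.
      by apply: (agree' 1%N j) => //; rewrite (path_diag p1 kk2); lia.
    have kk3 : (k.-2.+1 < k)%N by lia.
    by have := down1 _ kk3; rewrite qE -e (_ : k.-2.+1 = k.-1) ?eqxx //; lia.
  have dq := congr1 diag e; rewrite diag_above in dq.
  have [pj _ _] := bP j jk; have [i ik [qE di]] := path_diagP pj qS.
  have j1 : (1 < j)%N.
    have [jE|] := eqVneq j 1%N; last by lia.
    by rewrite jE in di; lia.
  (* A box below would carry the label of [d 1]. No later stair starts with that label, and each
     enters it rightwards, as [s] is least there. *)
  have di' : d j + i%:Z = d 1%N + k%:Z by rewrite /d in d1 di *; lia.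
  case: i ik qE di di' => [|i] ik qE di di'.
    have := slt 1%N j k1' jk j1; rewrite -(sp (d 1%N)) -di' addr0 ltxx //.
  have := steps j i jk ik; rewrite di' sp slt // => /eqP e'.
  have iE : b j i = b 1%N k.-1.
    apply: (agree' j 1%N) => //; first by case: pj => mem _ _; apply: mem; lia.
    by rewrite (path_diag pj) ?(ltnW ik) // d1 -/(d j) -/(d 1%N); lia.
  have := path_step pj ik; rewrite e' eqxx => /esym/negP; apply.
  by rewrite iE e qE.
have genk : b k 0%N \in generators SK.
  have bS : b k 0%N \in S k by case: pk => mem _ _; apply: mem.
  apply/generatorsP; split; first by apply/memSK; exists k.
  move=> q /memSK[j jk qS]; split=> e.
    have dq := congr1 diag e; rewrite diag_right -/(d k) in dq.
    have [pj _ _] := bP j jk; have [i ik [qE di]] := path_diagP pj qS.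
    have jk' : (j < k)%N.
      have [jk'|] := eqVneq j k; last by lia.
      by rewrite jk' in di; rewrite /d in dq; lia.
    (* The next label along [S j] is that of [d k], where [s] is largest, so it is entered downwards
       and [q] cannot be on its left. *)
    have di' : d j + i.+1%:Z = d k by rewrite /d in dq *; lia.
    have sjk := slt j k jk kk' jk'.
    have [ik'|ik'] := eqVneq i.+1 k.
      by move: sjk; rewrite -di' ik' sp ltxx.
    have ik2 : (i.+1 < k)%N by lia.
    have := steps j i jk ik2; rewrite di' [RHS]ltNge (ltW sjk) /= => /negP; apply.
    rewrite -qE -e; apply/eqP; apply: (agree' k j) => //.
      by case: pj => mem _ _; apply: mem.
    by rewrite (path_diag pj ik2) -/(d j) di'.
  have dq := congr1 diag e; rewrite diag_above -/(d k) in dq.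
  have qE : b k 1%N = q.
    apply: (agree' k j) => //; first by case: pk => mem _ _; apply: mem.
    by rewrite (path_diag pk k1) -/(d k); lia.
  have := rightk 0%N k1; rewrite (path_step pk k1) => /negP; apply.
  by rewrite qE -e.
have [T [T' [aT aT' gT']]] := sg.
have [v hv] := same_abstract_generators aT'.
have [v' hv'] := same_abstract_diag (same_abstract_sym aT).
have [b0 p0] := stair_path GS0.
have back p : p \in generators SK -> exists2 i, (i < k)%N & diag p = diag (b0 0%N) + i%:Z - v - v'.
  move=> /hv[p' ]; rewrite -gT' => /generatorsP[p'T _] e.
  have [q qS e'] := hv' _ p'T; have [i ik [_ di]] := path_diagP p0 qS.
  by exists i => //; lia.
(* Diagonals in a path of [k] boxes differ by at most [k - 1], and the first generator is at
   [d 1 + k - 1]; hence [d k <= d 1 + 2k - 2]. *)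
have [i1 ik1 e1] := back _ gen1; have [i2 ik2 e2] := back _ genk.
have kk1 : (k.-1 < k)%N by lia.
have d1 := path_diag p1 kk1.
have [||c [B o]] := short_ordered k1 sp sep rk.
- by move=> j jk; apply: dlt; lia.
- by rewrite /d; lia.
exists c, B; rewrite KE; exact: order_chamberE.
Qed.

(** * The chamber of a given order is simple *)

Section OrderChamber.
Variables (c : 'I_k) (B : {ffun 'I_(k - 2) -> bool}).
Local Notation P := (turn_pos B).
Local Notation bK := (chamber_walk c B).

Section Window.
Variable v : nat.
Hypotheses (vP : v = P (v %% k)) (v_small : (v < k.*2.-1)%N).
Let wp := window_path k0 k1 c vP v_small.

Lemma window_stable (th : stability gT) : order_chamber c B th ->
  stable g0 xi th (stair_module rG (segment bK v k)).
Proof.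
move=> oth; have [th0 o] := oth.
have [i ik|_ ne] := path_stability wp th0; last first.
  by apply: ne => i ik; have [] := window_order k1 vP v_small o ik.
have [-> _] := window_order k1 vP v_small o ik.
by case: ifP => [/ltW|/negbT]; rewrite -?leNgt.
Qed.

Lemma window_toric : toric rG (stair_module rG (segment bK v k)).
Proof.
have cM := stair_constellation wp.
split=> //; last exact: stair_torus_equivariant.
have [th oth] := ordered_exists k0 k1 c B.
exact: (stable_indecomposable oth.1 cM (window_stable oth)).
Qed.

Lemma window_chamber_stable :
  chamber_stable rG g0 xi (order_chamber c B) (stair_module rG (segment bK v k)).
Proof.
by split; [exact: (stair_constellation wp) | exact: window_stable].
Qed.

Lemma window_stair_of : stair_of rG (stair_module rG (segment bK v k)) (segment bK v k).
Proof.
split; first exact: (path_stair wp).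
exists \1%VF; split=> [|g||]; rewrite ?comp_lfun1l ?comp_lfun1r //.
by exists id => x; rewrite id_lfunE.
Qed.

Lemma window_width : width (segment bK v k) = (\sum_(i < k) (P i < v)).+1%N.
Proof.
have [th oth] := ordered_exists k0 k1 c B.
rewrite (stable_width oth.1 wp (window_stable oth)); congr _.+1.
by case: oth => _; exact: window_rank.
Qed.

End Window.

Lemma order_chamber_simple : simple_chamber rG g0 xi (order_chamber c B).
Proof.
have [th oth] := ordered_exists k0 k1 c B.
split; first by exists th; [exact: order_chamber_gen oth | rewrite (order_chamberE oth)].
have [v [v1 vgap vP vex vb]] := turn_enum k0 k1 B.
pose S j := segment bK (v j) k.
pose SK := (\bigcup_(j <- iota 1 k) S j)%fset.
have vlt i j : (0 < i)%N -> (i < j <= k)%N -> (v i < v j)%N.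
  by apply: (@increasing_between _ nat) => l /vgap/andP[].
have vle i j : (0 < i)%N -> (i <= j <= k)%N -> (v i <= v j)%N.
  by move=> i0 ij; have [->//|ne] := eqVneq i j; apply/ltnW/vlt => //; lia.
have kk1 : (k.-1 < k)%N by rewrite prednK.
(* The witness of simplicity is the stair of the label [c - 1], which starts at position [k - 1]. *)
have [j0 j0k vj0] := vex _ kk1.
rewrite /turn_pos (second_turn_last k0 k1) muln0 addn0 in vj0.
have gens : generators (S j0) = generators SK := window_generators k0 k1 c B v1 vgap vb j0k vj0.
have refl T : same_abstract k T T by exists (0, 0)%N, (0, 0)%N.
exists (stair_module rG (S j0)), (S j0), SK; split.
- by apply: window_toric; [apply: (vP _ j0k).1 | apply: vb].
- by apply: window_chamber_stable; [apply: (vP _ j0k).1 | apply: vb].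
- by apply: window_stair_of; [apply: (vP _ j0k).1 | apply: vb].
- exists (fun j => stair_module rG (S j)), S; split=> // j jk.
    have [vj cj] := vP j jk; have vbj := vb j jk; split.
    + exact: window_toric.
    + exact: window_chamber_stable.
    + exact: window_stair_of.
    + by rewrite window_width // cj; lia.
  have jk1 : (0 < j <= k)%N by lia. have jk2 : (0 < j.+1 <= k)%N by lia.
  apply: window_consecutive; rewrite ?vb ?vgap //; first exact: (vP j jk1).1.
  move=> i /vex[j' j'k <-]; have [le|lt] := leqP j' j; first by rewrite vle //; lia.
  by rewrite (vle j.+1 j') ?orbT //; lia.
- by exists (S j0), SK.
Qed.

End OrderChamber.

Lemma order_chamber_inj c c' B B' :
  order_chamber c B = order_chamber c' B' -> c = c' /\ B = B'.
Proof.
move=> e; have [th oth] := ordered_exists k0 k1 c B.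
have : order_chamber c' B' th by rewrite -e.
case: oth => _ o [_ o']; exact: (ordered_inj k0 k1 (psum_periodic k0 th) o o').
Qed.

Lemma card_simple_chambers :
  ([set K | simple_chamber rG g0 xi K]%classic #= `I_(k * 2 ^ (k - 2)))%card.
Proof.
pose T : finType := ('I_k * {ffun 'I_(k - 2) -> bool})%type.
pose f (x : 'I_#|T|) := order_chamber (enum_val x).1 (enum_val x).2.
have cT : #|T| = (k * 2 ^ (k - 2))%N by rewrite card_prod card_ord card_ffun card_bool card_ord.
have -> : [set K | simple_chamber rG g0 xi K]%classic = (f @` [set: 'I_#|T|])%classic.
  apply/seteqP; split=> [K /simple_order_chamber[c [B ->]]|_ [x _ <-]].
    2: exact: order_chamber_simple.
  by exists (enum_rank (c, B)) => //; rewrite /f enum_rankK.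
rewrite -cT; apply: card_eq_trans (card_esym card_II).
apply: inj_card_eq => x y _ _ /order_chamber_inj[e1 e2]; apply: enum_val_inj.
by rewrite [LHS]surjective_pairing e1 e2 -surjective_pairing.
Qed.
End Characters.

(** * Diagonal coordinates *)

(** The minimal polynomial divides [X^k - 1], which is separable since [k] is nonzero in [F]. *)
Lemma finite_order_diagonalizable (F : closedFieldType) (n k : nat) (A : 'M[F]_n.+1) :
  k%:R != 0 :> F -> A ^+ k = 1 -> diagonalizable A.
Proof.
move=> k0 Ak; apply/diagonalizableP.
have [r rE] := closed_field_poly_normal ('X^k - 1 : {poly F}).
have kpos : (0 < k)%N by case: (k) k0 => //; rewrite eqxx.
rewrite lead_coefXnsubC // scale1r in rE.
exists r; first by rewrite -separable_prod_XsubC -rE separable_Xn_sub_1.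
by apply: mxminpoly_min; rewrite -rE rmorphB rmorphXn /= horner_mx_X rmorph1 Ak subrr.
Qed.

(** A faithful character embeds the group in the units of a field, whose finite subgroups are
    cyclic; a generator keeps its order. *)
Lemma faithful_char_primitive (F : fieldType) (gT : finGroupType) (f : gT -> F) :
  {morph f : u v / (u * v)%g >-> u * v} -> (forall g, f g = 1 <-> g = 1%g) ->
  exists2 g, <[g]>%g = [set: gT]%SET & #|gT|.-primitive_root (f g).
Proof.
move=> fM f1.
have /cyclicP[g gE] : cyclic [set: gT].
  by apply: (field_mul_group_cyclic (f := f)) => [u v _ _|x _]; [exact: fM | exact: f1].
exists g => //; have fX n : f (g ^+ n)%g = f g ^+ n.
  elim: n => [|n IH]; first by rewrite expg0 expr0; apply/f1.
  by rewrite expgS fM IH exprS.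
have og : #[g]%g = #|gT| by rewrite orderE -gE cardsT.
apply/andP; split; first by rewrite -og order_gt0.
apply/forallP => i; apply/eqP; rewrite unity_rootE -fX.
have -> : (f (g ^+ i.+1)%g == 1) = (g ^+ i.+1 == 1)%g by apply/eqP/eqP => /f1.
rewrite -order_dvdn og; apply/idP/eqP => [/dvdn_leq h|->//].
by apply/eqP; rewrite eqn_leq ltn_ord h.
Qed.

Lemma diag_rowE (F : pzRingType) n (v : 'I_n -> F) i j :
  diag_mx (\row_(l < n) v l) i j = v j *+ (i == j).
Proof. by rewrite !mxE; case: eqVneq => [->|_]. Qed.

Lemma diag_coords_exist (F : closedFieldType) (gT : finGroupType)
    (rG : mx_representation F [set: gT] 2) :
  #|gT|%:R != 0 :> F -> mx_faithful rG -> (forall g, \det (rG g) = 1) ->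
  abelian [set: gT] -> inhabited (diag_coords rG).
Proof.
move=> k0 faith det1 ab.
pose fs := [seq rG g | g <- enum gT].
have cd : {in fs &, forall A B, comm_mx A B} /\ {in fs, forall A, diagonalizable A}.
  split=> [_ _ /mapP[g _ ->] /mapP[h _ ->]|_ /mapP[g _ ->]].
    by rewrite /comm_mx -!repr_mxM ?inE // (centsP ab) ?inE.
  apply: (finite_order_diagonalizable k0).
  rewrite -repr_mxX ?inE // (_ : g ^+ #|gT| = 1)%g ?repr_mx1 //.
  by rewrite -cardsT expg_cardG // inE.
have [Q Qu /allP Qdiag] := (codiagonalizableP fs).1 cd.
pose D := rconj_repr rG Qu.
have D0 g (i j : 'I_2) : i != j -> D g i j = 0.
  have /Qdiag/similar_diagPp h : rG g \in fs by apply: map_f; rewrite mem_enum.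
  by move=> ij; rewrite -(h i j ij) conjumx.
have Ddet g : D g 0 0 * D g 1 1 = 1.
  have <- : \det (D g) = 1.
    rewrite /D /= /rconj_mx !det_mulmx det1 mulr1 det_inv divff //.
    by have := Qu; rewrite unitmxE unitfE.
  rewrite [in RHS](_ : D g = diag_mx (\row_(i < 2) D g i i)); last first.
    apply/matrixP => i j; rewrite diag_rowE; have [->|ne] := eqVneq i j; first by rewrite mulr1n.
    by rewrite mulr0n D0.
  rewrite det_diag (eq_bigr (fun i => D g i i)) => [|i _]; last by rewrite mxE.
  rewrite !big_ord_recl big_ord0 mulr1.
  by rewrite (_ : lift ord0 ord0 = 1 :> 'I_2) //; exact: val_inj.
have DE g : D g = diag_mx (\row_(i < 2) (if i == 0 then (D g 1 1)^-1 else D g 1 1)).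
  have u : D g 1 1 != 0.
    by apply/eqP => z; have := Ddet g; rewrite z mulr0 => /esym/eqP; rewrite oner_eq0.
  apply/matrixP => i j; rewrite diag_rowE; have [->|ne] := eqVneq i j; last by rewrite mulr0n D0.
  rewrite mulr1n; case: (eqVneq j 0) => [->|j0]; first by apply: (mulIf u); rewrite Ddet mulVf.
  by rewrite (_ : j = 1) //; case: (j) j0 => -[|[|]] // ? _; apply: val_inj.
(* Determinant 1 makes the two diagonal entries inverse to each other, so the lower one alone is a
   faithful character. *)
have [g0 g0E prim] : exists2 g, <[g]>%g = [set: gT]%SET & #|gT|.-primitive_root (D g 1 1).
  apply: (faithful_char_primitive (f := fun g => D g 1 1)) => [g h|g].
    rewrite repr_mxM ?inE // mxE !big_ord_recl big_ord0 addr0.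
    rewrite [D g 1 ord0]D0 // mul0r add0r (_ : lift ord0 ord0 = 1 :> 'I_2) //; exact: val_inj.
  split=> [D1|->]; last by rewrite repr_mx1 mxE.
  apply: (mx_faithful_inj (rG := D)); rewrite ?inE ?repr_mx1 //.
    by rewrite /mx_faithful rker_conj.
  rewrite DE D1 invr1 -diag_const_mx; congr diag_mx; apply/rowP => i.
  by rewrite !mxE if_same.
by exists; exists Q Qu g0 (D g0 1 1).
Qed.

Theorem theorem6p15 (R : realType) (gT : finGroupType)
    (rG : mx_representation R[i] [set: gT]%G 2) (k : nat)
    (rG_faithful : mx_faithful rG)
    (rG_SL2 : forall g : gT, \det (rG g) = 1)
    (G_abelian : abelian [set: gT])
    (cardG : #|gT| = k) (k_gt1 : (1 < k)%N) :
  inhabited (diag_coords rG) /\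
  forall d : diag_coords rG,
    (simple_chambers d #= `I_(k * 2 ^ (k - 2)))%card.
Proof.
subst k; split=> [|d].
  by apply: diag_coords_exist => //; rewrite pnatr_eq0 -lt0n ltnW.
exact: (card_simple_chambers (dc_prim d) (dc_generates d) (dc_diag d)).
Qed.
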